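(* Let $d>1$. Given a set $P\subset\mathbb{Z}^d$ of zero upper-Banach density, there exist a totally strictly ergodic $\mathbb{Z}^d$-action $(X,\mathcal{B},\mu,T)$ and a continuous function $f:X\to\mathbb{R}$ such that the ergodic averages $$\frac{1}{|P\cap(-n,n)^d|}\sum_{g\in P\cap(-n,n)^d} f(T^gx)$$ fail to converge (as $n\to+\infty$) for a residual set of $x\in X$. In addition, $(X,\mathcal{B},\mu,T)$ can have arbitrarily large topological entropy.
   Context: $(-n,n)=\{-n+1,\dots,n-1\}$ and $[r,r+n)=\{r,\dots,r+n-1\}$ denote integer intervals. The upper-Banach density of $P\subset\mathbb{Z}^d$ is $d^*(P)=\limsup_{n_1,\dots,n_d\to+\infty}\ \sup_{(r_1,\dots,r_d)\in\mathbb{Z}^d}\frac{|P\cap [r_1,r_1+n_1)\times\cdots\times[r_d,r_d+n_d)|}{n_1\cdots n_d}$. Here $X$ is a compact metric space with Borel $\sigma$-algebra $\mathcal{B}$, $T$ is an action of $\mathbb{Z}^d$ on $X$ by homeomorphisms, and $T^g:X\to X$ is the map associated with $g\in\mathbb{Z}^d$. For a subgroup $F\le\mathbb{Z}^d$, $T|_F$ denotes the restricted $F$-action. An action of $F$ is minimal if every orbit is dense, uniquely ergodic if it has exactly one invariant Borel probability measure, and strictly ergodic if it is both. The $\mathbb{Z}^d$-action is totally strictly ergodic if, for every subgroup $F\le\mathbb{Z}^d$ of finite index, $(X,T|_F)$ is strictly ergodic. The measure $\mu$ is the unique $T$-invariant Borel probability measure. A residual set is one containing a countable intersection of dense open sets.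 $h(X,T)$ denotes the topological entropy of the $\mathbb{Z}^d$-action; for a subshift (a closed shift-invariant $X\subset\mathcal{C}^{\mathbb{Z}^d}$, $\mathcal{C}$ a finite alphabet, with $(T^gx)(h)=x(g+h)$) it is $h(X,T)=\lim_{n\to\infty} n^{-d}\log\left|\{x|_{[0,n)^d} : x\in X\}\right|$. ''Arbitrarily large topological entropy'' means that for every real $M\ge 0$ such an action and function can be chosen with $h(X,T)\ge M$.
   Formalization: The set P is additionally assumed infinite: for finite nonempty P the averages are eventually constant, so they converge for every x and the claim fails, and for empty P the averages are undefined (0/0). *)

(* Defs.v *)
From HB Require Import structures.
From mathcomp Require Import all_boot all_order all_algebra.
From mathcomp Require Import finmap.
From mathcomp Require Import all_classical all_reals all_analysis.

Set Implicit Arguments.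
Unset Strict Implicit.
Unset Printing Implicit Defensive.

Import Order.TTheory GRing.Theory Num.Theory.
Import numFieldNormedType.Exports.

Local Open Scope classical_set_scope.
Local Open Scope ring_scope.

(* The library builds measurable types on pointed types only.  Pointedness
   costs no generality here: a uniquely ergodic system carries a probability
   measure, hence is nonempty. *)
#[short(type="pmetricType")]
HB.structure Definition PMetric (K : numDomainType) :=
  {M of Metric K M & isPointed M}.

Section lattice.
Context {d : nat}.
Implicit Types (P F : set 'rV[int]_d) (r : 'rV[int]_d) (n : 'rV[nat]_d).

Definition box r n : set 'rV[int]_d :=
  [set g : 'rV[int]_d |
    forall i, r ord0 i <= g ord0 i < r ord0 i + (n ord0 i)%:Z].

Definition sym_cube (n : nat) : set 'rV[int]_d :=
  [set g : 'rV[int]_d | forall i, - n%:Z < g ord0 i < n%:Z].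

Definition all_infty : set_system 'rV[nat]_d :=
  filter_from [set: nat]
    (fun N => [set n : 'rV[nat]_d | forall i, (N <= n ord0 i)%N]).

(* fset_set is meaningful because boxes are finite; the quotient's value when
   some side is 0 is irrelevant to the limsup. *)
Definition upper_banach_density (R : realType) P : \bar R :=
  limf_esup (fun n : 'rV[nat]_d => ereal_sup
      [set ((#|` fset_set (P `&` box r n)|)%:R
             / (\prod_(i < d) n ord0 i)%N%:R : R)%:E | r in [set: 'rV[int]_d]])
    all_infty.

Definition is_subgroup F := F 0 /\ forall g h, F g -> F h -> F (g - h).

Definition finite_index F :=
  finite_set (range (fun g : 'rV[int]_d => [set g + h | h in F])).

End lattice.

Section topology.
Context {X : topologicalType}.

Definition residual (S : set X) :=
  exists U : (set X)^nat,
    (forall k, open (U k) /\ dense (U k)) /\ \bigcap_k U k `<=` S.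

Definition open_cover (C : set (set X)) :=
  C `<=` open /\ \bigcup_(A in C) A = [set: X].

(* The inf is over the sizes of finite subcovers (families may repeat members,
   which does not affect the minimum). *)
Definition subcover_number (R : realType) (C : set (set X)) : R :=
  inf [set (k%:R : R) | k in [set k : nat | exists B : 'I_k -> set X,
         (forall i, C (B i)) /\ \bigcup_i B i = [set: X]]].

End topology.

Section action.
Context {R : realType} {d : nat} {X : pmetricType R}.
Implicit Types (T : 'rV[int]_d -> X -> X) (F P : set 'rV[int]_d).

(* Each T g is a homeomorphism, with inverse T (- g). *)
Definition continuous_action T :=
  [/\ forall x, T 0 x = x,
      forall g h x, T (g + h) x = T g (T h x) &
      forall g, continuous (T g)].

Definition borelType : measurableType _ := g_sigma_algebraType (@open X).

Definition invariant_under T F (mu : probability borelType R) :=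
  forall g, F g -> forall A : set borelType, measurable A ->
    mu (T g @^-1` A) = mu A.

Definition minimal_action T F := forall x, dense [set T g x | g in F].

(* Library measures are functions on all subsets, with unspecified values on
   non-measurable ones, so uniqueness is stated on Borel sets only. *)
Definition uniquely_ergodic T F :=
  exists mu : probability borelType R, invariant_under T F mu /\
    forall nu : probability borelType R, invariant_under T F nu ->
      forall A : set borelType, measurable A -> nu A = mu A.

Definition strictly_ergodic T F := minimal_action T F /\ uniquely_ergodic T F.

Definition totally_strictly_ergodic T :=
  forall F, is_subgroup F -> finite_index F -> strictly_ergodic T F.

(* The common refinement of the covers T^{-g} C, g in [0,n)^d. *)
Definition cover_join T (C : set (set X)) (n : nat) : set (set X) :=
  [set \bigcap_(g in box 0 (const_mx n)) (T g @^-1` A g) |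
    A in [set A : 'rV[int]_d -> set X |
           forall g, box 0 (const_mx n) g -> C (A g)]].

(* Adler-Konheim-McAndrew entropy; the limsup is a limit, by subadditivity. *)
Definition cover_entropy T (C : set (set X)) : \bar R :=
  limn_esup (fun n : nat =>
    (ln (subcover_number R (cover_join T C n)) / (n ^ d)%N%:R)%:E).

Definition topological_entropy T : \bar R :=
  ereal_sup [set cover_entropy T C | C in open_cover].

Definition ergodic_average T P (f : X -> R) (x : X) (n : nat) : R :=
  (#|` fset_set (P `&` sym_cube n)|)%:R^-1
    * \sum_(g \in P `&` sym_cube n) f (T g x).

End action.
Arguments borelType {R} X.

(* Main.v *)
From HB Require Import structures.
From mathcomp Require Import all_boot all_order all_algebra all_fingroup.
From mathcomp Require Import zify ring lra.
From mathcomp Require Import finmap.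
From mathcomp Require Import all_classical all_reals all_analysis.
From mathcomp Require Import measurable_realfun.
Require Import Defs.

(** The system is a subshift over a finite alphabet, and f tests the letter at 0.
    Blocks of level k are patterns on a cube of side N_k.  A block of level k+1 is
    an array of blocks of level k, with one extra layer of cells in each direction,
    in which every block of level k occurs equally often, up to a small error, in
    every residue class modulo k!.  The subshift consists of the configurations all
    of whose windows occur in blocks.

    Equidistribution makes the frequencies of local events converge uniformly in the
    point, along the lattices k! Z^d; every subgroup of finite index contains such a
    lattice for large k, so the system is totally uniquely ergodic.  The invariant
    measure is the Caratheodory extension of the frequencies.  Minimality holds since
    each block of level k+1 contains all blocks of level k, in all residue classes.

    Since P has zero upper Banach density, the blocks of level k meeting P are fewer
    than the tolerated error.  Hence any block extends to a point whose letters on P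
    outside that block are arbitrary: averages along P above 2/3, or below 1/3, occur
    infinitely often on a dense G_delta.

    For the entropy, arrange the blocks of level k by permutations: as
    s! >= (s/e)^s, the entropy per cell drops by at most about N_k^{-d} at level k. *)

Set Implicit Arguments.
Unset Strict Implicit.
Unset Printing Implicit Defensive.
Import Order.TTheory GRing.Theory Num.Theory.
Import numFieldNormedType.Exports.
Local Open Scope classical_set_scope.
Local Open Scope ring_scope.

(** * Patterns and hierarchical blocks *)

(** Two demands conflict: unique ergodicity wants the blocks rigidly equidistributed, while the
    letters along [P] must be free. The tolerance [e] reconciles them: the share of sites it
    represents is fixed first, by level k alone, and only then is the side of level k+1 taken so
    large that [P] meets fewer sites than that. Since a block may sit anywhere, [P] has to be sparse
    uniformly over all translates of a cube. The layer of extra cells keeps all sides congruent to 1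
    modulo k!, so the counted site [u] starts at a position congruent to [u] + 1, and residues of
    sites become residues of cells. When a block runs through all classes, each of its cells meets
    the lattice k! Z^d exactly once; hence the lattice sees the plain mean over blocks, whatever its
    offset. As this lattice has density k!^-d, all errors must be small against k!^-d. The
    convergence of these means over the levels is not computed: averaging over a window of one level
    commutes with averaging over a window of another, which compares any two levels. *)

Notation cube d N := {ffun 'I_d -> 'I_N}.
Notation pat d C N := {ffun cube d N -> C}.

Section patterns.
Variables (d : nat) (C : finType) (c0 : C).
Local Notation V := 'rV[int]_d.
Local Notation cfg := (V -> C).

Definition vec (f : 'I_d -> nat) : V := \row_i (f i)%:Z.
Definition cell N (i : cube d N) : V := vec (fun k => i k).
Definition shift (g : V) (x : cfg) : cfg := fun h => x (g + h).
Definition restr N (x : cfg) : pat d C N := [ffun i => x (cell i)].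
(** Padding by [c0] lets the conditions on blocks be stated for configurations only. *)
Definition ext N (b : pat d C N) : cfg :=
  fun g => if [pick i | cell i == g] is Some i then b i else c0.

Lemma vecD f g : vec f + vec g = vec (fun k => f k + g k)%N.
Proof. by apply/rowP => k; rewrite !mxE PoszD. Qed.

Lemma vec_inj f g : vec f = vec g -> f =1 g.
Proof. by move=> /rowP E k; have := E k; rewrite !mxE => -[]. Qed.

Lemma cell_inj N : injective (@cell N).
Proof. by move=> i j /vec_inj E; apply/ffunP => k; exact/val_inj/E. Qed.

Lemma shift0 x : shift 0 x = x.
Proof. by apply/funext => h; rewrite /shift add0r. Qed.

Lemma shiftD g h x : shift (g + h) x = shift h (shift g x).
Proof. by apply/funext => k; rewrite /shift addrA. Qed.

Lemma ext_cell N (b : pat d C N) i : ext b (cell i) = b i.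
Proof.
rewrite /ext; case: pickP => [j /eqP/cell_inj ->//|/(_ i)]; by rewrite eqxx.
Qed.

Lemma extK N : cancel (@ext N) (restr N).
Proof. by move=> b; apply/ffunP => i; rewrite ffunE ext_cell. Qed.

Definition vcell N (f : 'I_d -> nat) (fN : forall k, (f k < N)%N) : cube d N :=
  [ffun k => Ordinal (fN k)].

Lemma cell_vcell N f fN : cell (@vcell N f fN) = vec f.
Proof. by apply/rowP => k; rewrite !mxE ffunE. Qed.

Lemma box0P N (g : V) :
  box 0 (const_mx N) g <-> exists i : cube d N, g = cell i.
Proof.
split=> [bg|[i -> k]]; last by have := ltn_ord (i k); rewrite !mxE; lia.
have gN k : (`|g ord0 k| < N)%N by have := bg k; rewrite !mxE; lia.
exists (vcell gN); rewrite cell_vcell; apply/rowP => k; rewrite mxE.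
by have := bg k; rewrite !mxE ord1; lia.
Qed.

Record level := Level { side : nat; blocks : {set pat d C side} }.

Definition blk (L : level) (x : cfg) := restr (side L) x \in blocks L.

Lemma blk_ext (L : level) b : b \in blocks L -> blk L (ext b).
Proof. by rewrite /blk extK. Qed.

Lemma eq_blk L x y : (forall i : cube d (side L), x (cell i) = y (cell i)) ->
  blk L x = blk L y.
Proof.
move=> E; suff S : restr (side L) x = restr (side L) y by rewrite /blk S.
by apply/ffunP => i; rewrite !ffunE.
Qed.

(* Consecutive copies of [0, N), except for one extra cell in front of site [a].
   This spacer lies between two copies, so that spacers of different levels are
   never adjacent, and it prevents the side of a block from dividing the side of
   the next one, which would produce a periodic factor. *)
Definition pos (N a t : nat) : nat := t * N + (a <= t).

Lemma pos_lt N a t t' : (t < t')%N -> (pos N a t + N <= pos N a t')%N.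
Proof. by move=> tt'; rewrite /pos; nia. Qed.

Lemma pos_inj N a t t' i i' : (i < N)%N -> (i' < N)%N ->
  (pos N a t + i = pos N a t' + i')%N -> t = t' /\ i = i'.
Proof.
move=> iN iN' E; suff tt' : t = t' by split=> //; subst; lia.
case: (ltngtP t t') => // /(pos_lt N a); lia.
Qed.

(** * Arranging blocks into a block of the next level *)

Section next.
Variables (L : level) (a p m e z : nat).
Local Notation N := (side L).

Definition posv (t : 'I_d -> nat) : V := vec (fun k => pos N a (t k)).
Definition site (x : cfg) (t : cube d (a + p)) : pat d C N :=
  restr N (shift (posv (fun k => t k)) x).
Definition reg (u : cube d p) : cube d (a + p) := [ffun k => rshift a (u k)].
Definition eqmod (u v : 'I_d -> nat) := [forall k, u k == v k %[mod m]].
(* Only the sites [t] with all coordinates at least [a] are counted. *)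
Definition occ (x : cfg) (c : cube d m) (b : pat d C N) : nat :=
  #|[pred u : cube d p | eqmod (fun k => u k) (fun k => c k)
                         & site x (reg u) == b]|.
(* [z] is the number of occurrences of a block in a residue class when blocks
   are equidistributed, and [e] the tolerance that leaves the blocks meeting [P]
   free. *)
Definition nextP (x : cfg) : bool :=
  [forall t, site x t \in blocks L] &&
  [forall c, [forall b in blocks L, (occ x c b <= z + e)%N && (z <= occ x c b + e)%N]].
Definition next : level :=
  @Level ((a + p) * N).+1 [set b | nextP (ext b)]%SET.

Lemma reg_inj : injective reg.
Proof.
move=> u v /ffunP E; apply/ffunP => k; have := E k.
by rewrite !ffunE => /rshift_inj.
Qed.

Definition scell (t : cube d (a + p)) (i : cube d N) : V :=
  posv (fun k => t k) + cell i.

Lemma scell_lt (t : cube d (a + p)) (i : cube d N) k :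
  (pos N a (t k) + i k < ((a + p) * N).+1)%N.
Proof. by have := ltn_ord (t k); have := ltn_ord (i k); rewrite /pos; nia. Qed.

Lemma scellE t i : scell t i = cell (vcell (scell_lt t i)).
Proof. by rewrite cell_vcell /scell /posv /cell vecD. Qed.

Lemma scell_inj t t' i i' : scell t i = scell t' i' -> t = t' /\ i = i'.
Proof.
rewrite /scell /posv /cell !vecD => /vec_inj E.
by split; apply/ffunP => k; apply/val_inj;
  have [] := pos_inj (ltn_ord (i k)) (ltn_ord (i' k)) (E k).
Qed.

Lemma siteE x t i : site x t i = x (scell t i).
Proof. by rewrite ffunE. Qed.

Lemma eq_nextP x y :
  (forall i : cube d ((a + p) * N).+1, x (cell i) = y (cell i)) ->
  nextP x = nextP y.
Proof.
move=> E; have S t : site x t = site y t.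
  by apply/ffunP => i; rewrite !siteE scellE E.
rewrite /nextP; under eq_forallb => t do rewrite S.
congr (_ && _); apply: eq_forallb => c; apply: eq_forallb => b.
suff -> : occ x c b = occ y c b by [].
by rewrite /occ; apply: eq_card => u; rewrite !inE S.
Qed.

Lemma blk_next x : blk next x = nextP x.
Proof.
by rewrite /blk /= inE; apply: eq_nextP => i; rewrite ext_cell ffunE.
Qed.

(** Each [y t] is read in the coordinates of its own block; cells that belong to no site are taken
    from [w]. *)
Definition glue (y : cube d (a + p) -> cfg) (w : cfg) : cfg := fun g =>
  if [pick ti : cube d (a + p) * cube d N | scell ti.1 ti.2 == g] is Some ti
  then y ti.1 (cell ti.2) else w g.

Lemma glue_site y w t i : glue y w (scell t i) = y t (cell i).
Proof.
rewrite /glue; case: pickP => [[t' i']/= /eqP/scell_inj[-> ->]//|].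
by move=> /(_ (t, i)); rewrite eqxx.
Qed.

Lemma glue_spacer y w g : (forall t i, scell t i != g) -> glue y w g = w g.
Proof.
by move=> H; rewrite /glue; case: pickP => // ti E; have := H ti.1 ti.2; rewrite E.
Qed.

Lemma site_glue y w t : site (glue y w) t = restr N (y t).
Proof. by apply/ffunP => i; rewrite siteE glue_site ffunE. Qed.

End next.
End patterns.

(** * Counting *)

Section uniform_assignments.
Variables (S T K : finType) (cl : S -> K) (B : {set T}) (z : nat).
Hypothesis cardcl : forall c, #|[pred u | cl u == c]| = (z * #|B|)%N.

Definition uniform (f : {ffun S -> T}) :=
  [forall u, f u \in B] &&
  [forall c, [forall b in B, #|[pred u | (cl u == c) && (f u == b)]| == z]].

Let J := ('I_z * 'I_#|B|)%type.

Let card_slot c : #|{: J}| = #|[pred u | cl u == c]|.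
Proof. by rewrite card_prod !card_ord cardcl. Qed.

Let h (i : K * J) : S := enum_val (cast_ord (card_slot i.1) (enum_rank i.2)).

Let clh i : cl (h i) = i.1.
Proof. by apply/eqP; exact: (enum_valP (cast_ord (card_slot i.1) (enum_rank i.2))). Qed.

Let h_inj : injective h.
Proof.
move=> [c x] [c' x'] E; have := clh (c, x); rewrite E clh /= => cc'; subst c'.
by move: E => /enum_val_inj/cast_ord_inj/enum_rank_inj /= ->.
Qed.

Let cardS : #|S| = #|{: K * J}|.
Proof.
rewrite card_prod card_prod !card_ord -[LHS]sum1_card.
rewrite (partition_big cl predT (P := fun u => u \in S)) //= -sum_nat_const.
by apply: eq_bigr => c _; rewrite sum1_card cardcl.
Qed.

(** Each class is cut into [z] rows of [#|B|] slots, and every row is filled by a permutation of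
    [B]: an element then occurs once per row, hence [z] times per class. Distinct families of
    permutations give distinct assignments. *)
Lemma card_uniform : ((#|B|)`! ^ (z * #|K|) <= #|[pred f | uniform f]|)%N.
Proof.
have [g hg gh] : bijective h by apply: inj_card_bij => //; rewrite cardS.
pose F (s : {ffun K * 'I_z -> {perm 'I_#|B|}}) : {ffun S -> T} :=
  [ffun u => let: (c, (v, j)) := g u in enum_val (s (c, v) j)].
have Fh s c v j : F s (h (c, (v, j))) = enum_val (s (c, v) j).
  by rewrite ffunE hg.
have F_inj : injective F.
  move=> s t /ffunP E; apply/ffunP => -[c v]; apply/permP => j.
  by have := E (h (c, (v, j))); rewrite !Fh => /enum_val_inj.
have Fu s : uniform (F s).
  apply/andP; split.
    by apply/forallP => u; rewrite ffunE; case: (g u) => c [v j]; exact: enum_valP.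
  apply/forallP => c; apply/forall_inP => b bB; apply/eqP.
  (* The slot of row [v] that holds [b]; these are all the occurrences of [b] in class [c]. *)
  pose q v := h (c, (v, ((s (c, v))^-1)%g (enum_rank_in bB b))).
  have q_inj : injective q by move=> v w /h_inj[].
  rewrite -[RHS](card_ord z) -(card_codom q_inj); apply: eq_card => u.
  rewrite !inE; apply/andP/codomP => [[/eqP cu /eqP bu]|[v ->]].
    move: cu bu; rewrite -(gh u); case: (g u) => [c' [v j]].
    rewrite clh Fh /= => c'c bu; subst c'; exists v.
    rewrite /q; suff <- : s (c, v) j = enum_rank_in bB b by rewrite permK.
    by apply: enum_val_inj; rewrite enum_rankK_in.
  by rewrite clh Fh permKV enum_rankK_in.
rewrite -card_Sn -[X in (_ ^ (X * _))%N](card_ord z) mulnC -card_prod -card_ffun.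
rewrite -(card_codom F_inj); apply: subset_leq_card; apply/fintype.subsetP => f.
by move=> /codomP[s ->]; rewrite inE; exact: Fu.
Qed.

Lemma ex_uniform : exists f, uniform f.
Proof.
have := card_uniform; case: (pickP uniform) => [f uf _|H]; first by exists f.
by rewrite (eq_card0 H) leqNgt expn_gt0 fact_gt0.
Qed.

End uniform_assignments.

Section residues.
Variables (d m l : nat).
Hypothesis m_gt0 : (0 < m)%N.

Definition res p (u : cube d p) : cube d m :=
  [ffun k => Ordinal (ltn_pmod (u k) m_gt0)].

Lemma eqmod_res p (u : cube d p) (c : cube d m) :
  eqmod m (fun k => u k) (fun k => c k) = (res u == c).
Proof.
apply/forallP/eqP => [E|<- k]; last by rewrite ffunE /= modn_mod.
by apply/ffunP => k; apply/val_inj; rewrite ffunE /= (eqP (E k)) modn_small.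
Qed.

Lemma card_res c : #|[pred u : cube d (m * l) | res u == c]| = (l ^ d)%N.
Proof.
have lt (v : cube d l) k : (c k + m * v k < m * l)%N.
  by have := ltn_ord (c k); have := ltn_ord (v k); nia.
pose q v := vcell (lt v).
have qE v k : q v k = (c k + m * v k)%N :> nat by rewrite ffunE.
have q_inj : injective q.
  move=> v w /ffunP E; apply/ffunP => k; apply/val_inj.
  by have /(congr1 val)/= := E k; rewrite !qE => /addnI/eqP; rewrite eqn_pmul2l // => /eqP.
transitivity #|codom q|; last by rewrite card_codom // card_ffun !card_ord.
apply: eq_card => u; rewrite !inE; apply/eqP/codomP => [rc|[v ->]].
  have lv k : (u k %/ m < l)%N by have := ltn_ord (u k); rewrite ltn_divLR // (mulnC l).
  exists (vcell lv); apply/ffunP => k; apply/val_inj.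
  rewrite /= qE -rc !ffunE /= addnC [X in (X + _)%N]mulnC; exact: divn_eq.
apply/ffunP => k; apply/val_inj; rewrite ffunE /= qE addnC mulnC modnMDl modn_small //.
Qed.

End residues.

Section sums.
Variable R : realType.

(** The indices missed by [h] number [#|J| - #|I|], and each of their terms is at most 1. *)
Lemma sum_inj_close (I J : finType) (h : I -> J) (F : J -> R) :
  injective h -> (forall j, 0 <= F j <= 1) ->
  `|\sum_j F j - \sum_i F (h i)| <= #|J|%:R - #|I|%:R.
Proof.
move=> h_inj F01.
have -> : \sum_i F (h i) = \sum_(j in codom h) F j.
  rewrite [RHS](_ : _ = \sum_(j in [set h i | i in [set: I]]%SET) F j).
    by rewrite big_imset /=; [apply: eq_bigl => i; rewrite inE|move=> ? ? _ _ /h_inj].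
  apply: eq_bigl => j; apply/codomP/imsetP => [[i ->]|[i _ ->]]; by exists i; rewrite ?inE.
rewrite (bigID (fun j => j \in codom h)) /= addrC addrK ger0_norm; last first.
  by apply: sumr_ge0 => j _; have /andP[] := F01 j.
have -> : #|J|%:R - #|I|%:R = #|[predC codom h]|%:R :> R.
  have := cardC (mem (codom h)); rewrite card_codom // => <-.
  by rewrite natrD addrC addKr.
rewrite -sumr_const; apply: ler_sum => j _; by have /andP[] := F01 j.
Qed.

End sums.

(** * Properties of one step of the hierarchy *)

Section step.
Variables (d : nat) (C : finType) (c0 : C).
Local Notation V := 'rV[int]_d.
Local Notation cfg := (V -> C).
Variables (L : level d C) (a m l e z : nat).
Local Notation p := (m * l)%N.
Local Notation N := (side L).
Local Notation next := (next c0 L a p m e z).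
Local Notation s := #|blocks L|.
Hypothesis m_gt0 : (0 < m)%N.
(** A count within [e] of [z] cannot vanish when [e < z]. *)
Lemma blk_occurs x c b : (e < z)%N -> blk next x -> b \in blocks L ->
  exists2 u : cube d p, res m_gt0 u = c & site L x (reg a u) = b.
Proof.
rewrite blk_next => ez /andP[_ /forallP/(_ c)/forall_inP xb] /xb/andP[_].
case: (pickP [pred u : cube d p | eqmod m (fun k => u k) (fun k => c k) &
  site L x (reg a u) == b]) => [u /andP[]|O].
  by rewrite eqmod_res => /eqP ? /eqP ?; exists u.
by rewrite /occ (eq_card0 O); lia.
Qed.

Hypothesis zE : (z * s)%N = (l ^ d)%N.
Variables (b0 : pat d C N) (b0P : b0 \in blocks L).

Let cardcl (c : cube d m) : #|[pred u : cube d p | res m_gt0 u == c]| = (z * s)%N.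
Proof. by rewrite zE card_res. Qed.

(** Uncounted sites, those with a coordinate below [a], receive [b0]. *)
Definition fill (f : {ffun cube d p -> pat d C N}) (t : cube d (a + p)) : cfg :=
  if [pick u | reg a u == t] is Some u then ext c0 (f u) else ext c0 b0.

Lemma fill_reg f u : fill f (reg a u) = ext c0 (f u).
Proof.
rewrite /fill; case: pickP => [v /eqP/reg_inj ->//|/(_ u)]; by rewrite eqxx.
Qed.

Lemma blk_fill (f : {ffun cube d p -> pat d C N}) t :
  (forall u, f u \in blocks L) -> blk L (fill f t).
Proof. by move=> fL; rewrite /fill; case: pickP => [u _|_]; apply: blk_ext. Qed.

(** Start from an arrangement with exactly [z] occurrences of every block in each class; overwriting
    at most [e] sites moves each count by at most [e]. Spacers are unconstrained and copy [w]. *)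
Lemma blk_replace (A : {pred cube d (a + p)}) (y : cube d (a + p) -> cfg) (w : cfg) :
  (#|A| <= e)%N -> (forall t, t \in A -> blk L (y t)) ->
  exists x, [/\ blk next x,
    forall t i, t \in A -> x (scell (L := L) t i) = y t (cell i) &
    forall g, (forall (t : cube d (a + p)) i, scell (L := L) t i != g) -> x g = w g].
Proof.
move=> Ae yL; have [f /andP[/forallP fL /forallP fz]] := ex_uniform cardcl.
pose y' t := if t \in A then y t else fill f t.
have y'L t : blk L (y' t).
  by rewrite /y'; case: ifP => [/yL//|_]; exact: blk_fill.
exists (glue L y' w); split=> [|t i tA|g]; last exact: glue_spacer.
  rewrite blk_next; apply/andP; split.
    by apply/forallP => t; rewrite site_glue; exact: y'L.
  apply/forallP => c; apply/forall_inP => b bL.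
  have /forall_inP/(_ _ bL)/eqP zc := fz c.
  set Z := [pred u | _] in zc; rewrite /occ; set O := [pred u | _ & _].
  pose D := [pred u : cube d p | reg a u \in A].
  have De : (#|D| <= e)%N.
    apply: leq_trans Ae; rewrite -(fintype.card_image (@reg_inj _ a _) D).
    by apply: subset_leq_card; apply/fintype.subsetP => _ /fintype.imageP[u uA ->].
  have ODZ u : u \notin D -> (u \in O) = (u \in Z).
    rewrite !inE /= eqmod_res site_glue /y' => /negbTE ->.
    by rewrite fill_reg extK.
  have sub (X Y : {pred cube d p}) : (forall u, u \notin D -> u \in X -> u \in Y) ->
      (#|X| <= #|Y| + e)%N.
    move=> XY; apply: (@leq_trans (#|Y| + #|D|)); last by rewrite leq_add2l.
    rewrite -(cardUI (mem Y) (mem D)); apply: leq_trans (leq_addr _ _).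
    apply: subset_leq_card; apply/fintype.subsetP => u uX.
    apply/orP; case: (boolP (u \in D)) => [uD|uD]; first by right.
    by left; exact: XY.
  by rewrite -zc !sub // => u /ODZ ->.
by rewrite glue_site /y' tA.
Qed.

(** The exactly uniform arrangements alone are this numerous; this is the source of the entropy
    estimate. *)
Lemma card_blocks_next : ((s)`! ^ (z * m ^ d) <= #|blocks next|)%N.
Proof.
have := card_uniform cardcl; rewrite card_ffun !card_ord => /leq_trans; apply.
pose g (f : {ffun cube d p -> pat d C N}) := restr ((a + p) * N).+1 (glue L (fill f) (fun=> c0)).
have sg (f : {ffun cube d p -> pat d C N}) u : site L (glue L (fill f) (fun=> c0)) (reg a u) = f u.
  by rewrite site_glue fill_reg extK.
have g_inj : injective g.
  move=> f f' /ffunP E; apply/ffunP => u; rewrite -!sg; apply/ffunP => i.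
  rewrite !siteE scellE; have := E (vcell (scell_lt (reg a u) i)).
  by rewrite !ffunE.
rewrite -(fintype.card_image g_inj).
apply: subset_leq_card; apply/fintype.subsetP => _ /fintype.imageP[f uf ->].
have /andP[/forallP fL /forallP fz] : uniform (@res _ _ m_gt0 p) (blocks L) z f.
  by rewrite inE in uf.
suff : blk next (glue L (fill f) (fun=> c0)) by [].
rewrite blk_next; apply/andP; split.
  by apply/forallP => t; rewrite site_glue; exact: blk_fill.
apply/forallP => c; apply/forall_inP => b bL.
have /forall_inP/(_ _ bL)/eqP <- := fz c.
suff -> : occ a p (glue L (fill f) (fun=> c0)) c b =
  #|[pred u | (res m_gt0 u == c) && (f u == b)]| by rewrite !leq_addr.
by apply: eq_card => u; rewrite !inE /= eqmod_res sg.
Qed.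

End step.

(** * Frequencies of local events in a block *)

Section hits.
Variables (R : realType) (d : nat) (C : finType) (c0 : C).
Local Notation V := 'rV[int]_d.
Local Notation cfg := (V -> C).

Definition agree r (x y : cfg) := forall g, sym_cube r g -> x g = y g.
Definition local r (w : cfg -> bool) := forall x y, agree r x y -> w x = w y.

Definition hit m (w : cfg -> bool) (o : 'I_d -> nat) (x : cfg) (g : 'I_d -> nat) : R :=
  ([forall k, m %| o k + g k]%N && w (shift (vec g) x))%:R.
Definition hits m w N o x : R := \sum_(i : cube d N) hit m w o x (fun k => i k).

Lemma hit01 m w o x g : 0 <= hit m w o x g <= 1.
Proof. by rewrite /hit ler0n lern1 leq_b1. Qed.

Lemma hits_bound m w N o x : 0 <= hits m w N o x <= (N ^ d)%:R.
Proof.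
apply/andP; split; first by apply: sumr_ge0 => i _; case/andP: (hit01 m w o x (fun k => i k)).
have -> : (N ^ d)%:R = \sum_(i : cube d N) (1 : R).
  by rewrite sumr_const card_ffun !card_ord.
by apply: ler_sum => i _; case/andP: (hit01 m w o x (fun k => i k)).
Qed.

Lemma hitD m w o x f g :
  hit m w o x (fun k => f k + g k)%N = hit m w (fun k => o k + f k)%N (shift (vec f) x) g.
Proof.
rewrite /hit -vecD shiftD; congr (nat_of_bool (_ && _))%:R.
by apply: eq_forallb => k; rewrite addnA.
Qed.

Lemma hit_eqmod m w o o' x g : (forall k, o k = o' k %[mod m]) ->
  hit m w o x g = hit m w o' x g.
Proof.
move=> E; congr (nat_of_bool (_ && _))%:R; apply: eq_forallb => k.
by rewrite /dvdn -modnDml E modnDml.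
Qed.

Lemma cell_interior r N (i : cube d N) (g : V) :
  (forall k, r <= i k /\ i k + r <= N)%N -> sym_cube r g ->
  exists j : cube d N, vec (fun k => i k) + g = cell j.
Proof.
move=> ri rg; apply/box0P => k; have := ri k; have := rg k; rewrite !mxE ord1.
by move: (g 0 k) (nat_of_ord (i k)) => u v; move=> /andP[? ?] [? ?]; apply/andP; split; lia.
Qed.

(** At distance at least [r] from the border the event sees only cells where [x] and [y] agree. *)
Lemma hits_local r m w N o x y : local r w -> (r.*2 <= N)%N ->
  (forall i : cube d N, x (cell i) = y (cell i)) ->
  `|hits m w N o x - hits m w N o y| <= (N ^ d)%:R - ((N - r.*2) ^ d)%:R.
Proof.
move=> lw rN E; rewrite -sumrB.
pose F (i : cube d N) := `|hit m w o x (fun k => i k) - hit m w o y (fun k => i k)|.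
apply: (@le_trans _ _ (\sum_i F i)); first exact: ler_norm_sum.
have lt (i : cube d (N - r.*2)) k : (i k + r < N)%N by have := ltn_ord (i k); lia.
pose h i := vcell (lt i).
have h_inj : injective h.
  move=> i j /ffunP ij; apply/ffunP => k; apply/val_inj.
  by have /(congr1 val) := ij k; rewrite !ffunE /= => /addIn.
have Fh i : F (h i) = 0.
  rewrite /F /hit; suff -> : w (shift (vec (fun k => h i k)) x) =
    w (shift (vec (fun k => h i k)) y) by rewrite subrr normr0.
  apply: lw => g rg; have [|j] := @cell_interior r N (h i) g _ rg.
    by move=> k; rewrite ffunE /=; have := ltn_ord (i k); lia.
  by rewrite /shift => ->.
have S0 : \sum_i F (h i) = 0 by apply: big1 => i _; exact: Fh.
have := @sum_inj_close R _ _ h F h_inj; rewrite S0 subr0.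
rewrite !card_ffun !card_ord => H; apply: le_trans (ler_norm _) (H _) => i.
rewrite normr_ge0 /= /F ler_norml.
have := hit01 m w o x (fun k => i k); have := hit01 m w o y (fun k => i k).
by move=> /andP[? ?] /andP[? ?]; lra.
Qed.

(** Modulo [m] the side acts as 1 and [a] vanishes; the remaining 1 is the spacer. *)
Lemma pos_mod N a m u : (m %| a)%N -> N = 1 %[mod m] ->
  pos N a (a + u) = (u + 1)%N %[mod m].
Proof.
move=> ma N1; rewrite /pos leq_addr -modnDml -modnMmr N1 modnMmr muln1 modnDml.
by rewrite -addnA -modnDml (eqP ma) add0n.
Qed.

Section step_hits.
Variables (L : level d C) (a m l e z r : nat) (w : cfg -> bool).
Local Notation p := (m * l)%N.
Local Notation N := (side L).
Local Notation N' := ((a + m * l) * N).+1.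
Local Notation s := #|blocks L|.
Hypothesis m_gt0 : (0 < m)%N.
Hypotheses (ma : (m %| a)%N) (mN : N = 1 %[mod m]).
Hypotheses (lw : local r w) (rN : (r.*2 <= N)%N).

Definition block_hits : R :=
  \sum_(b in blocks L) \sum_(i : cube d N) (w (shift (cell i) (ext c0 b)))%:R.

(** The three errors come from cells in spacers or uncounted sites, from cells near the border of a
    sub-block, where the event depends on the surroundings, and from counts deviating from [z]. The
    main term does not involve [o]. *)
Lemma hits_next x o : blk (next c0 L a p m e z) x ->
  `|hits m w N' o x - z%:R * block_hits| <=
    ((N' ^ d)%:R - ((p * N) ^ d)%:R)
    + (p ^ d)%:R * ((N ^ d)%:R - ((N - r.*2) ^ d)%:R)
    + e%:R * (m ^ d)%:R * s%:R * (N ^ d)%:R.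
Proof.
rewrite blk_next => /andP[/forallP xL /forallP xocc].
pose o' (u : cube d p) k := (o k + pos N a (a + u k))%N.
pose y (u : cube d p) := shift (posv L a (fun k => a + u k)%N) x.
pose A := \sum_(u : cube d p) hits m w N (o' u) (y u).
pose B := \sum_(u : cube d p) hits m w N (o' u) (ext c0 (restr N (y u))).
have stepA : `|hits m w N' o x - A| <= (N' ^ d)%:R - ((p * N) ^ d)%:R.
  pose h (ui : cube d p * cube d N) : cube d N' := vcell (scell_lt (reg a ui.1) ui.2).
  have h_inj : injective h.
    move=> [u i] [u' i'] /(congr1 (@cell d _)); rewrite -!scellE.
    by move=> /scell_inj[/reg_inj/= -> ->].
  have := @sum_inj_close R _ _ h (fun j => hit m w o x (fun k => j k)) h_inj
    (fun j => hit01 m w o x _).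
  rewrite card_prod !card_ffun !card_ord -expnMn; apply: le_trans.
  rewrite le_eqVlt; apply/orP; left; apply/eqP; congr (`| _ - _|).
  rewrite /A -(pair_bigA _ (fun u i => hit m w o x (fun k => h (u, i) k))) /=.
  apply: eq_bigr => u _; apply: eq_bigr => i _.
  by rewrite -hitD; congr hit; apply/funext => k; rewrite !ffunE /= ffunE.
have stepB : `|A - B| <= (p ^ d)%:R * ((N ^ d)%:R - ((N - r.*2) ^ d)%:R).
  rewrite -sumrB; apply: le_trans (ler_norm_sum _ _ _) _.
  rewrite mulr_natl -[X in _ *+ (X ^ _)]card_ord -[X in _ *+ (_ ^ X)]card_ord.
  rewrite -card_ffun -sumr_const; apply: ler_sum => u _.
  by apply: (hits_local m _ lw rN) => i; rewrite ext_cell ffunE.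
(* A counted site of class [c] starts at a position congruent to [c] + 1, whence this offset. *)
pose G (c : cube d m) (b : pat d C N) := hits m w N (fun k => o k + 1 + c k)%N (ext c0 b).
have BE : B = \sum_c \sum_(b in blocks L) (occ a p x c b)%:R * G c b.
  rewrite /B (partition_big (res m_gt0 (p := p)) predT) //=.
  apply: eq_bigr => c _.
  rewrite (partition_big (fun u => site L x (reg a u)) (mem (blocks L))) /=; last first.
    by move=> u _; exact: xL.
  apply: eq_bigr => b bL; rewrite /occ -sum1_card natr_sum mulr_suml.
  rewrite [RHS](eq_bigl (fun u => (res m_gt0 u == c) && (site L x (reg a u) == b))); last first.
    by move=> u; rewrite inE /= eqmod_res.
  apply: eq_bigr => u /andP[/eqP uc /eqP ub]; rewrite mul1r /G -uc.
  have -> : restr N (y u) = b.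
    rewrite -ub /site.
    suff -> : posv L a (fun k => reg a u k) = posv L a (fun k => a + u k)%N by [].
    by apply/rowP => k; rewrite !mxE ffunE.
  apply: eq_bigr => i _; apply: hit_eqmod => k; rewrite /o' ffunE /=.
  by rewrite -modnDmr pos_mod // modnDmr modnDmr addnAC addnA.
(* For given [b] and [i], exactly one class puts the cell [i] on the lattice, so the sum over all
   classes forgets [o]. *)
have GE : \sum_c \sum_(b in blocks L) G c b = block_hits.
  rewrite exchange_big; apply: eq_bigr => b _; rewrite exchange_big.
  apply: eq_bigr => i _; rewrite /hit /=.
  have lt k : ((m - (o k + 1 + i k) %% m) %% m < m)%N by rewrite ltn_pmod.
  have cE (c : cube d m) : [forall k, m %| o k + 1 + c k + i k]%N = (c == vcell lt).
    apply/forallP/eqP => [H|-> k]; last first.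
      rewrite ffunE /= addnAC /dvdn -modnDmr modn_mod modnDmr -modnDml.
      by rewrite subnKC ?modnn // ltnW // ltn_pmod.
    apply/ffunP => k; apply/val_inj; rewrite ffunE /=.
    have := H k; rewrite addnAC; move: (_ + _ + i k)%N (ltn_ord (c k)) => n cm.
    rewrite /dvdn -modnDml; have := ltn_pmod n m_gt0.
    case: (posnP (n %% m)) => [->|n0 nm].
      by rewrite add0n subn0 modnn modn_small // => _ /eqP.
    rewrite [((m - _) %% m)%N]modn_small; last lia.
    case: (ltnP (n %% m + c k) m) => [h|h]; first by rewrite modn_small //; lia.
    rewrite -(subnK h) modnDr modn_small; lia.
  rewrite (bigD1 (vcell lt)) //= big1 ?addr0; last first.
    by move=> c /negbTE; rewrite cE => ->.
  by rewrite cE eqxx.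
have stepC : `|B - z%:R * block_hits| <= e%:R * (m ^ d)%:R * s%:R * (N ^ d)%:R.
  rewrite BE -GE mulr_sumr -sumrB; apply: le_trans (ler_norm_sum _ _ _) _.
  have -> : e%:R * (m ^ d)%:R * s%:R * (N ^ d)%:R =
      \sum_(c : cube d m) \sum_(b in blocks L) (e%:R * (N ^ d)%:R : R).
    by rewrite !sumr_const card_ffun !card_ord -[RHS]mulr_natr -[X in _ = X * _]mulr_natr; ring.
  apply: ler_sum => c _.
  rewrite mulr_sumr -sumrB; apply: le_trans (ler_norm_sum _ _ _) _.
  apply: ler_sum => b bL.
  rewrite -mulrBl normrM.
  have /andP[G0 GN] := hits_bound m w N (fun k => o k + 1 + c k)%N (ext c0 b).
  apply: ler_pM => //; last by rewrite ger0_norm.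
  have /forall_inP/(_ _ bL)/andP[] := xocc c.
  rewrite -!(ler_nat R) !natrD => h1 h2; rewrite ler_norml; apply/andP; split; lra.
have -> : hits m w N' o x - z%:R * block_hits =
  (hits m w N' o x - A) + (A - B) + (B - z%:R * block_hits) by ring.
apply: le_trans (ler_normD _ _) _; apply: lerD => //.
by apply: le_trans (ler_normD _ _) _; exact: lerD.
Qed.

End step_hits.
End hits.

(** * The subshift of a tower of blocks *)

Section tower.
Variables (d : nat) (C : finType) (c0 : C).
Local Notation V := 'rV[int]_d.
Local Notation cfg := (V -> C).
Variables (P : set V) (Lv : nat -> level d C) (a m l e z : nat -> nat).
Local Notation N k := (side (Lv k)).
Local Notation q k := (a k + m k * l k)%N.

(** [tower_a] and [tower_N] make residues of sites and of cells correspond. The strict inequality in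
    [tower_P] leaves room for one prescribed site besides those meeting [P]. *)
Record tower : Prop := Tower {
  tower0 : Lv 0 = @Level d C 1 [set: _]%SET;
  towerS : forall k, Lv k.+1 = next c0 (Lv k) (a k) (m k * l k) (m k) (e k) (z k);
  tower_m : forall k, (0 < m k)%N;
  tower_q : forall k, (2 < q k)%N;
  tower_z : forall k, (z k * #|blocks (Lv k)| = l k ^ d)%N;
  tower_e : forall k, (e k < z k)%N;
  tower_a0 : forall k, (0 < a k)%N;
  tower_l : forall k, (0 < l k)%N;
  tower_a : forall k, (m k %| a k)%N;
  tower_N : forall k, N k = 1 %[mod m k];
  tower_P : forall k (v : V),
    (#|[pred i : cube d (N k.+1) | `[< P (v + cell i)%R >]]| < e k)%N
}.
Hypothesis TW : tower.

Lemma side_gt0 k : (0 < N k)%N.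
Proof. by case: k => [|k]; rewrite ?(tower0 TW) ?(towerS TW). Qed.

Lemma sideS k : N k.+1 = (q k * N k).+1.
Proof. by rewrite (towerS TW). Qed.

Lemma ex_block k : exists b, b \in blocks (Lv k).
Proof.
elim: k => [|k [b bL]].
  by rewrite (tower0 TW); exists [ffun=> c0]; rewrite inE.
have := card_blocks_next c0 (a k) (e k) (tower_m TW k) (tower_z TW k) bL.
rewrite -(towerS TW); case: (pickP (mem (blocks (Lv k.+1)))) => [b' ? _|H].
  by exists b'.
by rewrite (eq_card0 H) leqNgt expn_gt0 fact_gt0.
Qed.

Lemma ex_blk k : exists x, blk (Lv k) x.
Proof. by have [b bL] := ex_block k; exists (ext c0 b); exact: blk_ext. Qed.

Lemma blkS k x : blk (Lv k.+1) x ->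
  blk (next c0 (Lv k) (a k) (m k * l k) (m k) (e k) (z k)) x.
Proof. by rewrite (towerS TW). Qed.

Lemma blkS_occurs k x y (o : 'I_d -> nat) : blk (Lv k.+1) x -> blk (Lv k) y ->
  exists f : 'I_d -> nat, [/\ forall i, (f i + N k <= N k.+1)%N,
    forall i, (m k %| o i + f i)%N &
    forall j : cube d (N k), x (vec f + cell j) = y (cell j)].
Proof.
move=> /blkS xb yb; have m0 := tower_m TW k.
(* The class [c] for which [o] + 1 + [c] is divisible by [m k]; the 1 comes from the spacer. *)
have lt i : ((m k - (o i + 1) %% m k) %% m k < m k)%N by rewrite ltn_pmod.
have [u uc ub] := @blk_occurs d C c0 (Lv k) (a k) (m k) (l k) (e k) (z k) m0
  x (vcell lt) _ (tower_e TW k) xb yb.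
exists (fun i => pos (N k) (a k) (a k + u i)); split=> [i|i|j].
- by rewrite sideS; have := ltn_ord (u i); rewrite /pos; nia.
- rewrite /dvdn -modnDmr pos_mod ?(tower_a TW) ?(tower_N TW) // modnDmr addnCA.
  move/ffunP: uc => /(_ i)/(congr1 val); rewrite !ffunE /= => uc.
  rewrite -modnDml uc modnDml; move: (o i + 1)%N => n.
  by rewrite -modnDmr subnK ?modnn // ltnW // ltn_pmod.
- have := siteE x (reg (a k) u) j; rewrite ub ffunE => ->.
  by rewrite /scell /posv; congr (x (vec _ + _)); apply/funext => i; rewrite ffunE.
Qed.

Definition appears k r (x : cfg) := exists2 y, blk (Lv k) y & exists v : V,
  forall g, sym_cube r g -> box 0 (const_mx (N k)) (v + g) /\ x g = y (v + g).

Definition tower_shift : set cfg := [set x | forall r, exists k, appears k r x].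
Local Notation X := tower_shift.

(** A block of level k occurs in every block of level k+1. *)
Lemma appearsS k r x : appears k r x -> appears k.+1 r x.
Proof.
move=> [y yb [v vy]]; have [y' y'b] := ex_blk k.+1.
have [f [fN _ fy]] := blkS_occurs (fun=> 0%N) y'b yb.
exists y' => //; exists (vec f + v) => g /vy[/box0P[j vj] ->].
rewrite -addrA vj fy; split => //.
by apply/box0P; rewrite [cell j]/cell vecD; have lt i : (f i + j i < N k.+1)%N;
  [have := fN i; have := ltn_ord (j i); lia | exists (vcell lt); rewrite cell_vcell].
Qed.

Lemma appears_ge k j r x : appears k r x -> appears (k + j) r x.
Proof. by move=> H; elim: j => [|j IH]; rewrite ?addn0 // addnS; exact: appearsS. Qed.

Lemma tower_shift_closed x : (forall r, exists2 y, X y & agree r x y) -> X x.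
Proof.
move=> H r; have [y yX xy] := H r; have [k [w wb [v vw]]] := yX r.
by exists k, w => //; exists v => g rg; have [? <-] := vw _ rg; rewrite xy.
Qed.

Lemma sym_cubeD (g : V) : exists n, forall r h, sym_cube r h -> sym_cube (r + n) (g + h).
Proof.
exists (\sum_i `|g ord0 i|)%N => r h rh i; rewrite !mxE (bigD1 i) //=.
by have := rh i; move: (\sum_(j | _) _)%N (g ord0 i) (h ord0 i) => n x y; lia.
Qed.

Lemma tower_shift_invariant g x : X x -> X (shift g x).
Proof.
move=> xX r; have [n ng] := sym_cubeD g; have [k [y yb [v vy]]] := xX (r + n)%N.
exists k, y => //; exists (v + g) => h /(ng r)/vy[].
by rewrite -addrA.
Qed.

(** Coordinates at which blocks of level [k] begin inside a block of level [k + j]. Sites form a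
    product grid, so one coordinate at a time suffices. *)
Fixpoint start k j : nat -> Prop :=
  if j is j'.+1 then fun s => exists t s', [/\ (t < q (k + j'))%N, start k j' s' &
    s = (pos (N (k + j')) (a (k + j')) t + s')%N]
  else fun s => s = 0%N.

Lemma start_blk k j y (f : 'I_d -> nat) : blk (Lv (k + j)) y ->
  (forall i, start k j (f i)) -> blk (Lv k) (shift (vec f) y).
Proof.
elim: j y f => [|j IH] y f /=.
  rewrite addn0 => yb f0; suff -> : vec f = 0 by rewrite shift0.
  by apply/rowP => i; rewrite !mxE f0.
rewrite addnS => /blkS; rewrite blk_next => /andP[/forallP yb _] fS.
have [t /choice[s' tP]] := choice fS.
have tq i : (t i < q (k + j))%N by have [] := tP i.
have := yb (vcell tq); rewrite /site -/(blk (Lv (k + j)) _).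
move=> /IH/(_ (fun i => let: And3 _ s _ := tP i in s)); rewrite -shiftD.
suff -> : vec f = posv (Lv (k + j)) (a (k + j)) (fun i => vcell tq i) + vec s' by [].
by rewrite /posv vecD; apply/rowP => i; rewrite !mxE ffunE /=; have [_ _ ->] := tP i.
Qed.

Lemma start_le k j s : start k j s -> (s + N k <= N (k + j))%N.
Proof.
elim: j s => [|j IH] s /=; first by move=> ->; rewrite addn0.
move=> [t [s' [tq /IH s'N ->]]]; rewrite addnS sideS /pos; nia.
Qed.

Lemma start_sep k j s s' : start k j s -> start k j s' -> (s < s')%N -> (s + N k <= s')%N.
Proof.
elim: j s s' => [|j IH] s s' /=; first by move=> -> ->.
move=> [t [r [_ rS ->]]] [t' [r' [_ r'S ->]]].
have [tt|tt|->] := ltngtP t t'; last by rewrite -addnA ltn_add2l leq_add2l; exact: IH.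
  by have := pos_lt (N (k + j)) (a (k + j)) tt; have := start_le rS; lia.
by have := pos_lt (N (k + j)) (a (k + j)) tt; have := start_le r'S; lia.
Qed.

Lemma start0 k j : start k j 0.
Proof.
elim: j => //= j IH; exists 0%N, 0%N; split => //; first by have := tower_q TW (k + j); lia.
by rewrite /pos mul0n leqNgt (tower_a0 TW).
Qed.

Lemma posS n b t : pos n b t.+1 = (pos n b t + n + (t.+1 == b))%N.
Proof.
rewrite /pos mulSn leq_eqVlt eq_sym ltnS; case: eqVneq => [<-|_] /=; last by lia.
by rewrite ltnn; lia.
Qed.

(** A spacer lies strictly between two sites, never at an end of a block, so spacers of different
    levels do not add up and a gap has at most one cell. *)
Lemma start_next k j s : start k j s -> (s + N k < N (k + j))%N ->
  start k j (s + N k) \/ start k j (s + N k).+1.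
Proof.
elim: j s => [|j IH] s; first by rewrite /= addn0 => ->; lia.
move=> [t [r [tq rS ->]]] lt; have := start_le rS.
rewrite leq_eqVlt => /orP[/eqP rN|/(IH _ rS) [H|H]].
- rewrite -addnA rN; case: (ltnP t.+1 (q (k + j))) => [tq'|qt].
    case: (boolP (t.+1 == a (k + j))) => ta; [right|left];
      exists t.+1, 0%N; split; rewrite ?posS ?(negbTE ta) ?ta; try exact: start0; lia.
  (* For the last [t], which lies beyond the spacer, the block of level [k] ends together with the
     whole block. *)
  move: lt; rewrite -addnA rN addnS sideS /pos; have := tower_l TW (k + j).
  have := tower_m TW (k + j); nia.
- by left; exists t, (r + N k)%N; rewrite addnA.
- by right; exists t, (r + N k).+1; rewrite addnS addnA.
Qed.

Lemma start_ex k j v : (v + N k <= N (k + j))%N ->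
  exists s, [/\ start k j s, (v <= s)%N & (s <= v + N k)%N].
Proof.
elim: v => [|v IH] vN; first by exists 0%N; split => //; exact: start0.
have [|s [sS vs sv]] := IH; first by lia.
case: (ltnP v s) => [?|sv']; first by exists s; split => //; lia.
have Es : s = v by lia. subst s.
have N0 := side_gt0 k.
by have [|?|?] := start_next sS; [lia|exists (v + N k)%N|exists (v + N k).+1]; split => //; lia.
Qed.

(** In each coordinate, consecutive intervals of [N k] + 1 integers each contain a start, and
    distinct starts are at least [N k] apart. A large window of [x] lies in one high block, where
    all these starts are found. *)
Lemma tower_tiling x k J : X x -> exists f : 'I_d -> nat -> nat,
  [/\ forall i j, (j < J)%N -> (f i j + N k <= J.+1 * (N k).+1)%N,
      forall i j j', (j < j')%N -> (j' < J)%N -> (f i j + N k <= f i j')%N &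
      forall j : cube d J, blk (Lv k) (shift (vec (fun i => f i (j i))) x)].
Proof.
move=> xX; set n := (J.+1 * (N k).+1)%N.
have [k' /(appears_ge k)] := xX n.+1; rewrite addnC => -[y yb [v vy]].
have sn (g : 'I_d -> nat) : (forall i, (g i < n.+1)%N) -> sym_cube n.+1 (vec g).
  by move=> gn i; have := gn i; rewrite mxE; lia.
have vN (g : 'I_d -> nat) : (forall i, (g i < n.+1)%N) ->
    exists h : cube d (N (k + k')), v + vec g = cell h.
  by move=> /sn/vy[/box0P[h ->] _]; exists h.
have [h0 v0] := vN (fun=> 0%N) (fun=> isT).
have vE : v = cell h0 by rewrite -v0; apply/rowP => i; rewrite !mxE addr0.
have hn i : (h0 i + n < N (k + k'))%N.
  have [h hE] := vN (fun=> n) (fun=> ltnSn _).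
  move/rowP/(_ i): hE; rewrite vE !mxE; have := ltn_ord (h i).
  by move: (nat_of_ord (h i)) (nat_of_ord (h0 i)) => u w; lia.
have stx i j : exists s, (j < J)%N -> [/\ start k k' s, (h0 i + j * (N k).+1 <= s)%N &
    (s <= h0 i + j * (N k).+1 + N k)%N].
  case: (ltnP j J) => jJ; last by exists 0%N.
  have [|s sP] := @start_ex k k' (h0 i + j * (N k).+1)%N; last by exists s.
  by have := hn i; rewrite /n; nia.
have st2 i : exists g : nat -> nat, forall j, (j < J)%N -> [/\ start k k' (g j),
    (h0 i + j * (N k).+1 <= g j)%N & (g j <= h0 i + j * (N k).+1 + N k)%N].
  by have [g gP] := choice (stx i); exists g.
have [F FP] := choice st2.
exists (fun i j => F i j - h0 i)%N; split=> [i j jJ|i j j' jj' jJ|j].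
- by have [_ ? ?] := FP i j jJ; nia.
- have [S1 ? ?] := FP i j (ltn_trans jj' jJ); have [S2 ? ?] := FP i j' jJ.
  have lt : (F i j < F i j')%N by nia.
  by have := start_sep S1 S2 lt; nia.
have FS i : start k k' (F i (j i)) by have [] := FP i (j i) (ltn_ord (j i)).
suff -> : blk (Lv k) (shift (vec (fun i => F i (j i) - h0 i)%N) x) =
  blk (Lv k) (shift (vec (fun i => F i (j i))) y) by exact: (start_blk yb FS).
apply: eq_blk => c.
rewrite /shift [cell c]/cell !vecD; set g := (fun i => F i (j i) - h0 i + c i)%N.
have [|_ ->] := vy (vec g).
  apply: sn => i; rewrite /g; have [_ ? ?] := FP i (j i) (ltn_ord (j i)).
  by have := ltn_ord (c i); have := ltn_ord (j i); rewrite /n; nia.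
rewrite vE /cell vecD; congr (y (vec _)); apply/funext => i; rewrite /g.
by have [_ ? ?] := FP i (j i) (ltn_ord (j i)); nia.
Qed.

End tower.

(** * Points with prescribed values *)

Section tower_points.
Variables (d : nat) (C : finType) (c0 : C).
Local Notation V := 'rV[int]_d.
Local Notation cfg := (V -> C).
Variables (P : set V) (Lv : nat -> level d C) (a m l e z : nat -> nat).
Local Notation N k := (side (Lv k)).
Local Notation q k := (a k + m k * l k)%N.
Hypothesis TW : tower c0 P Lv a m l e z.

Local Notation inbox k v := (box v (const_mx (N k))).

Lemma boxP n (v g : V) : box v (const_mx n) g <-> exists i : cube d n, g = v + cell i.
Proof.
rewrite -[box v _ g](_ : box 0 (const_mx n) (g - v) = _); last first.
  by apply/propext; split=> H i; have := H i; rewrite !mxE; move: (v _ i) (g _ i) => b c;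
    by move=> /andP[? ?]; apply/andP; split; lia.
rewrite box0P; split=> -[i E]; exists i; first by rewrite -E addrC subrK.
by rewrite E addrC addKr.
Qed.

(** Fewer than [e k] sites meet [P]; with at most one more in [A0] the tolerance is respected, so
    all of them may carry arbitrary blocks. Those off [A0] carry blocks that follow [u] on [P], and
    the spacers copy [u]. *)
Lemma fill_block k (v : V) (u : cfg) (A0 : {pred cube d (q k)}) (Ys : cube d (q k) -> cfg) :
  (#|A0| <= 1)%N ->
  (forall t, t \in A0 -> blk (Lv k) (shift (v + posv (Lv k) (a k) (fun i => t i)) (Ys t))) ->
  (forall w, exists2 Y, blk (Lv k) (shift w Y) &
     forall g, inbox k w g -> P g -> Y g = u g) ->
  exists Y, [/\ blk (Lv k.+1) (shift v Y),
    forall t i, t \in A0 -> Y (v + scell (L := Lv k) t i) = Ys t (v + scell (L := Lv k) t i) &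
    forall g, inbox k.+1 v g -> P g ->
      (forall t i, t \in A0 -> g <> v + scell (L := Lv k) t i) -> Y g = u g].
Proof.
move=> A01 YsL IH.
pose pv (t : cube d (q k)) := v + posv (Lv k) (a k) (fun i => t i).
have /choice[YI YIP] : forall t, exists Y, blk (Lv k) (shift (pv t) Y) /\
    forall g, inbox k (pv t) g -> P g -> Y g = u g.
  by move=> t; have [Y ? ?] := IH (pv t); exists Y.
pose B (t : cube d (q k)) := `[< exists i, P (v + scell (L := Lv k) t i)%R >].
pose A := [pred t | (t \in A0) || B t].
have Ae : (#|A| <= e k)%N.
  have Be : (#|[pred t | B t]| < e k)%N.
    apply: leq_ltn_trans (tower_P TW k v).
    have /choice[wit witP] : forall t, exists i, B t -> P (v + scell (L := Lv k) t i)%R.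
      move=> t; case: (asboolP (exists i, P (v + scell (L := Lv k) t i)%R)) => [[i Pi]|nB].
        by exists i.
      by exists [ffun=> Ordinal (side_gt0 TW k)] => /asboolP.
    have lt (t : cube d (q k)) i : (pos (N k) (a k) (t i) + wit t i < N k.+1)%N.
      by rewrite (sideS TW); exact: scell_lt.
    pose F t := vcell (lt t).
    have FE t : cell (F t) = scell (L := Lv k) t (wit t).
      by rewrite cell_vcell /scell /posv /cell vecD.
    have F_inj : injective F.
      by move=> t t' /(congr1 (@cell d _)); rewrite !FE => /scell_inj[].
    rewrite -(fintype.card_image F_inj); apply: subset_leq_card; apply/fintype.subsetP => j.
    move=> /fintype.imageP[t tB ->]; rewrite inE; apply/asboolP; rewrite FE.
    move: tB; rewrite inE => tB; apply/asboolP; by apply: witP; apply/asboolP.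
  apply: leq_trans (_ : #|A0| + #|[pred t | B t]| <= _)%N; last by lia.
  rewrite -(cardUI (mem A0)); apply: leq_trans (leq_addr _ _).
  by apply: subset_leq_card; apply/fintype.subsetP.
pose yt (t : cube d (q k)) := shift (pv t) (if t \in A0 then Ys t else YI t).
have ytL t : blk (Lv k) (yt t).
  by rewrite /yt; case: ifP => [/YsL|_] //; have [] := YIP t.
have [bk bkL] := ex_block TW k.
have [x [xL xA xw]] := blk_replace c0 (tower_m TW k) (tower_z TW k) bkL (shift v u)
  Ae (fun t _ => ytL t).
exists (shift (- v) x).
have Yx h : shift (- v) x (v + h) = x h by rewrite /shift addKr.
split=> [|t i tA|g /boxP[j gE] Pg nA].
- rewrite (towerS TW) -shiftD addNr shift0; exact: xL.
- by rewrite Yx xA ?inE ?tA // /yt tA /shift addrA.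
- have [[t [i E]]|H] := pselect (exists (t : cube d (q k)) i,
    scell (L := Lv k) t i = cell j); rewrite gE Yx.
    have tB : B t by apply/asboolP; exists i; rewrite E -gE.
    rewrite -E xA ?inE ?tB ?orbT // /yt; case: ifP => tA.
      by case: (nA t i tA); rewrite gE E.
    rewrite /shift /pv -addrA -/(scell t i); have [_ ->] := YIP t; rewrite ?E -?gE //.
    apply/boxP; exists i; by rewrite gE -E /scell addrA.
  by rewrite xw // => t i; apply/eqP => E; apply: H; exists t, i.
Qed.


Lemma free_block k w (u : cfg) : exists2 Y, blk (Lv k) (shift w Y) &
  forall g, inbox k w g -> P g -> Y g = u g.
Proof.
elim: k w => [|k IH] w.
  by exists u => //; rewrite (tower0 TW) /blk inE.
have [||Y [YL _ Yu]] := @fill_block k w u pred0 (fun=> u) _ _ IH.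
- by rewrite card0.
- by [].
- by exists Y => // g gw Pg; exact: Yu.
Qed.

Lemma extend_block k (v : V) (Y u : cfg) : blk (Lv k) (shift v Y) ->
  exists w : V * cfg, [/\ blk (Lv k.+1) (shift w.1 w.2),
    forall g, inbox k v g -> w.2 g = Y g,
    forall g, inbox k.+1 w.1 g -> P g -> ~ inbox k v g -> w.2 g = u g &
    forall i, w.1 ord0 i < v ord0 i /\
      v ord0 i + (N k)%:Z < w.1 ord0 i + (N k.+1)%:Z].
Proof.
move=> YL; have q2 := tower_q TW k; have q1 : (1 < q k)%N by lia.
(* The site with all coordinates 1 is interior in every direction, because [q k] exceeds 2; this
   makes the successive blocks exhaust Z^d. *)
pose t0 : cube d (q k) := vcell (fun=> q1).
pose w := v - posv (Lv k) (a k) (fun i => t0 i).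
have wv : w + posv (Lv k) (a k) (fun i => t0 i) = v by rewrite subrK.
have [||Y' [Y'L Y'Y Y'u]] := @fill_block k w u (pred1 t0) (fun=> Y) _ _
  (fun w => free_block k w u).
- by rewrite card1.
- by move=> t; rewrite inE => /eqP ->; rewrite wv.
have scE i : w + scell (L := Lv k) t0 i = v + cell i by rewrite addrA wv.
exists (w, Y'); split=> //= [g /boxP[i ->]|g gw Pg ng|i].
- by rewrite -scE Y'Y ?inE.
- apply: Y'u => // t i; rewrite inE => /eqP -> E; apply: ng.
  by apply/boxP; exists i; rewrite E scE.
- rewrite !mxE ffunE /= (sideS TW); have := side_gt0 TW k.
  move: (v ord0 i) (N k) => x n n0.
  have : (0 < pos n (a k) 1)%N by rewrite /pos; lia.
  have : (pos n (a k) 1 + n < (q k * n).+1)%N by rewrite /pos; nia.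
  by move: (pos _ _ _) (q k * n)%N => s s'; split; lia.
Qed.

(** Extend the block level by level. The boxes gain at least one cell on every side at each step,
    hence cover Z^d, and a value once set is never changed. *)
Lemma ex_point k (v : V) (Y u : cfg) : blk (Lv k) (shift v Y) ->
  exists x, [/\ tower_shift Lv x, forall g, inbox k v g -> x g = Y g &
    forall g, P g -> ~ inbox k v g -> x g = u g].
Proof.
move=> YL.
have /choice[nx nxP] : forall kw : nat * (V * cfg), exists w : V * cfg,
    blk (Lv kw.1) (shift kw.2.1 kw.2.2) -> [/\ blk (Lv kw.1.+1) (shift w.1 w.2),
    forall g, inbox kw.1 kw.2.1 g -> w.2 g = kw.2.2 g,
    forall g, inbox kw.1.+1 w.1 g -> P g -> ~ inbox kw.1 kw.2.1 g -> w.2 g = u g &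
    forall i, w.1 ord0 i < kw.2.1 ord0 i /\
      kw.2.1 ord0 i + (N kw.1)%:Z < w.1 ord0 i + (N kw.1.+1)%:Z].
  move=> [j [v' Y']] /=; have [bl|nb] := boolP (blk (Lv j) (shift v' Y')).
    by have [w wP] := extend_block u bl; exists w.
  by exists (v', Y').
pose fix s j := if j is j'.+1 then nx ((k + j')%N, s j') else (v, Y).
have sL j : blk (Lv (k + j)) (shift (s j).1 (s j).2).
  elim: j => [|j IH]; first by rewrite addn0.
  by rewrite addnS; have [] := nxP (_, s j) IH.
have sS j : [/\ forall g, inbox (k + j) (s j).1 g -> (s j.+1).2 g = (s j).2 g,
    forall g, inbox (k + j).+1 (s j.+1).1 g -> P g -> ~ inbox (k + j) (s j).1 g ->
      (s j.+1).2 g = u g &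
    forall i, (s j.+1).1 ord0 i < (s j).1 ord0 i /\
      (s j).1 ord0 i + (N (k + j))%:Z < (s j.+1).1 ord0 i + (N (k + j).+1)%:Z].
  by have [_ ? ? ?] := nxP (_, s j) (sL j).
have boxS j g : inbox (k + j) (s j).1 g -> inbox (k + j.+1) (s j.+1).1 g.
  have [_ _ H] := sS j; move=> b i; have := b i; have := H i; rewrite addnS !mxE.
  move: (s j) (s j.+1) (N _) (N _) (g _ _) => w w' n n' h.
  by move: (w.1 _ _) (w'.1 _ _) => x x' [? ?] /andP[? ?]; apply/andP; split; lia.
have boxD j j' g : inbox (k + j) (s j).1 g ->
    inbox (k + (j + j')) (s (j + j')%N).1 g /\ (s (j + j')%N).2 g = (s j).2 g.
  move=> b; elim: j' => [|j' [b' E]]; first by rewrite addn0.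
  by rewrite addnS; split; [exact: boxS|have [H _ _] := sS (j + j')%N; rewrite H].
have grow j i : (s j).1 ord0 i + j%:Z <= v ord0 i /\
    v ord0 i + (N k)%:Z + j%:Z <= (s j).1 ord0 i + (N (k + j))%:Z.
  elim: j => [|j [H1 H2]]; first by rewrite /= addn0 !addr0.
  have [_ _ /(_ i)[H3 H4]] := sS j; rewrite addnS; move: H1 H2 H3 H4.
  move: (s j) (s j.+1) (N _) (N _) (N _) => w w' n n' n''.
  by move: (v _ _) (w.1 _ _) (w'.1 _ _) => x y y'; lia.
have boxr r (g : V) j : (\sum_i `|(v ord0 i)| <= j)%N -> sym_cube r g ->
    inbox (k + (r + j)) (s (r + j)%N).1 g.
  move=> vj rg i; rewrite !mxE; have [] := grow (r + j)%N i; have := rg i.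
  have : (`|v ord0 i| <= j)%N by apply: leq_trans vj; rewrite (bigD1 i) //= leq_addr.
  case: (s (r + j)%N) => w W /=.
  move: (N k) (N (k + _)) (g _ _) (v _ _) (w _ _) => n n' x y y' ? /andP[? ?] ? ?.
  by apply/andP; split; lia.
pose r0 (g : V) := (\sum_i `|g ord0 i|).+1%N.
have r0P g : sym_cube (r0 g) g.
  move=> i; rewrite /r0 (bigD1 i) //=; move: (\sum_(j | _) _)%N (g _ _) => n x.
  by apply/andP; split; lia.
pose J := (\sum_i `|(v ord0 i)|)%N.
(* At this stage the box contains [g]: [r0 g] bounds the coordinates of [g], and [J] those of
   [v]. *)
pose x g := (s (r0 g + J)%N).2 g.
have xE j g : inbox (k + j) (s j).1 g -> x g = (s j).2 g.
  move=> b; have b' := boxr _ g J (leqnn _) (r0P g).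
  have [_ E] := boxD _ (r0 g + J)%N _ b; have [_ E'] := boxD _ j _ b'.
  by rewrite /x -E' addnC E.
exists x; split=> [r|g b|g Pg nb].
- exists (k + (r + J))%N, (shift (s (r + J)%N).1 (s (r + J)%N).2) => //.
  exists (- (s (r + J)%N).1) => g rg; have b := boxr r g J (leqnn _) rg.
  have /boxP[i gE] := b; rewrite /shift addNKr (xE _ _ b); split=> //.
  by apply/box0P; exists i; rewrite gE addKr.
- by rewrite (xE 0%N) // addn0.
- have b := boxr _ g J (leqnn _) (r0P g); rewrite /x.
  elim: (r0 g + J)%N b => [|j IH] b; first by case: nb; move: b; rewrite addn0.
  have [bj|nbj] := pselect (inbox (k + j) (s j).1 g).
    by have [H _ _] := sS j; rewrite H //; exact: IH.
  by have [_ H _] := sS j; apply: H => //; rewrite -addnS.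
Qed.

End tower_points.

(** * Uniform frequencies *)

Lemma bernoulli_le (R : realType) (x : R) n : 0 <= x <= 1 -> 1 - x ^+ n <= n%:R * (1 - x).
Proof.
move=> /andP[x0 x1]; elim: n => [|n IH]; first by rewrite expr0 mul0r subrr.
have y0 : 0 <= x ^+ n by exact: exprn_ge0.
have y1 : x ^+ n <= 1 by exact: exprn_ile1.
have := ler_wpM2l x0 IH; rewrite exprS -natr1 => H.
have : 0 <= (1 - x) * (n%:R * (1 - x)) by rewrite !mulr_ge0 ?ler0n //; lra.
move: (x ^+ n) (n%:R : R) y0 y1 IH H => y c y0 y1 IH H H2; nra.
Qed.

Lemma cube_shrink (R : realType) (u v n : nat) : (u <= v)%N -> (0 < v)%N ->
  (v ^ n)%:R - (u ^ n)%:R <= (v ^ n)%:R * (n%:R * ((v - u)%N%:R / v%:R)) :> R.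
Proof.
move=> uv v0; have vR : 0 < v%:R :> R by rewrite ltr0n.
have /(@bernoulli_le R _ n) : 0 <= (u%:R / v%:R : R) <= 1.
  by rewrite divr_ge0 ?ler0n //= ler_pdivrMr // mul1r ler_nat.
have -> : 1 - u%:R / v%:R = (v - u)%N%:R / v%:R :> R.
  by rewrite natrB // mulrBl divff // gt_eqF.
move=> H; rewrite !natrX; have vn : 0 < v%:R ^+ n :> R by rewrite exprn_gt0.
have := ler_wpM2l (ltW vn) H; apply: le_trans.
by rewrite mulrBr mulr1 -exprMn mulrC divfK // gt_eqF.
Qed.

Lemma leq_expl u v n : (u <= v)%N -> (u ^ n <= v ^ n)%N.
Proof. by case: n => // n uv; rewrite leq_exp2r. Qed.

Section frequency.
Variables (R : realType) (d : nat) (C : finType) (c0 : C).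
Local Notation V := 'rV[int]_d.
Local Notation cfg := (V -> C).
Variables (P : set V) (Lv : nat -> level d C) (a m l e z : nat -> nat).
Local Notation N k := (side (Lv k)).
Local Notation q k := (a k + m k * l k)%N.
Local Notation s k := #|blocks (Lv k)|.
Hypothesis TW : tower c0 P Lv a m l e z.
(** The factors [m k ^ d] occur because the averages run over the lattice m_k Z^d: errors have to be
    of order 1 / k relative to its density. *)
Hypothesis TWshape : forall k, (N k.+1 ^ d)%:R - ((m k * l k * N k) ^ d)%:R <=
  (N k.+1 ^ d)%:R / (k.+1%:R * (m k ^ d)%:R) :> R.
Hypothesis TWe : forall k, (k.+1 * e k * (m k ^ d) * (m k ^ d) * s k <= (m k * l k) ^ d)%N.
Hypothesis TWN : forall k, (k * m k ^ d <= N k)%N.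
Hypothesis TWm : forall k, (m k <= m k.+1)%N.

(** So many blocks of level k+1 that the border of the window is negligible even against the density
    of the lattice. *)
Definition window_tiles k := (k.+1 * m k ^ d)%N.
Definition window_side k := ((window_tiles k).+1 * (N k.+1).+1)%N.
Definition avg_set k : seq V :=
  [seq cell i | i : cube d (window_side k) <- enum {: cube d (window_side k)} &
    [forall j, m k %| i j]%N].
Definition avg k (w : cfg -> bool) (x : cfg) : R :=
  (\sum_(g <- avg_set k) (w (shift g x))%:R) / (size (avg_set k))%:R.

Lemma hits_avg_set k (w : cfg -> bool) x :
  hits R (m k) w (window_side k) (fun=> 0%N) x = \sum_(g <- avg_set k) (w (shift g x))%:R.
Proof.
rewrite /avg_set big_map big_filter big_enum_cond /= /hits [RHS]big_mkcond /=.
apply: eq_bigr => i _; rewrite /hit.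
under eq_forallb => j do rewrite add0n.
by case: ifP.
Qed.

Lemma hits_window k r w x : local r w -> (r.*2 <= N k)%N -> tower_shift Lv x ->
  `|hits R (m k) w (window_side k) (fun=> 0%N) x
     - (window_tiles k ^ d)%:R * ((z k)%:R * block_hits R c0 (Lv k) w)| <=
  ((window_side k ^ d)%:R - ((window_tiles k * N k.+1) ^ d)%:R) +
  (window_tiles k ^ d)%:R * (((N k.+1 ^ d)%:R - ((m k * l k * N k) ^ d)%:R)
    + ((m k * l k) ^ d)%:R * ((N k ^ d)%:R - ((N k - r.*2) ^ d)%:R)
    + (e k)%:R * (m k ^ d)%:R * (s k)%:R * (N k ^ d)%:R).
Proof.
move=> lw rN xX; set err := (X in _ + (window_tiles k ^ d)%:R * X).
have [f [fN fsep fL]] := tower_tiling TW k.+1 (window_tiles k) xX.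
have lt (ji : cube d (window_tiles k) * cube d (N k.+1)) i :
    (f i (ji.1 i) + ji.2 i < window_side k)%N.
  have := fN i (ji.1 i) (ltn_ord _); have := ltn_ord (ji.2 i); rewrite /window_side; lia.
pose h ji := vcell (lt ji).
have h_inj : injective h.
  move=> [j i] [j' i'] /ffunP E.
  have E2 t : j t = j' t /\ i t = i' t.
    have /(congr1 val) := E t; rewrite !ffunE /= => Et.
    have [Hlt|Hlt|/val_inj jj] := ltngtP (j t) (j' t).
    - by have := fsep t _ _ Hlt (ltn_ord _); have := ltn_ord (i t); lia.
    - by have := fsep t _ _ Hlt (ltn_ord _); have := ltn_ord (i' t); lia.
    - by split=> //; apply/val_inj; move: Et; rewrite jj => /addnI.
  by congr pair; apply/ffunP => t; have [] := E2 t.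
have := @sum_inj_close R _ _ h (fun g => hit R (m k) w (fun=> 0%N) x (fun t => g t)) h_inj
  (fun g => hit01 R (m k) w _ x _).
rewrite card_prod !card_ffun !card_ord -expnMn -/(hits _ _ _ _ _ _) => H1.
pose B := \sum_(j : cube d (window_tiles k)) hits R (m k) w (N k.+1) (fun t => f t (j t))
  (shift (vec (fun t => f t (j t))) x).
have BE : \sum_ji hit R (m k) w (fun=> 0%N) x (fun t => h ji t) = B.
  pose G j i := hit R (m k) w (fun t => f t ((j : cube d (window_tiles k)) t))
    (shift (vec (fun t => f t (j t))) x) (fun t => (i : cube d (N k.+1)) t).
  rewrite /B /hits (pair_bigA _ G) /=; apply: eq_bigr => -[j i] _.
  rewrite /G /= -(hitD _ _ _ (fun=> 0%N)).
  by congr hit; apply/funext => t; rewrite ffunE.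
rewrite BE in H1.
have H2 : `|B - (window_tiles k ^ d)%:R * ((z k)%:R * block_hits R c0 (Lv k) w)| <=
    (window_tiles k ^ d)%:R * err.
  have -> : (window_tiles k ^ d)%:R * err = \sum_(j : cube d (window_tiles k)) err.
    by rewrite sumr_const card_ffun !card_ord mulr_natl.
  have -> : (window_tiles k ^ d)%:R * ((z k)%:R * block_hits R c0 (Lv k) w) =
    \sum_(j : cube d (window_tiles k)) ((z k)%:R * block_hits R c0 (Lv k) w).
    by rewrite sumr_const card_ffun !card_ord mulr_natl.
  rewrite -sumrB; apply: le_trans (ler_norm_sum _ _ _) _; apply: ler_sum => j _.
  have := hits_next R (tower_m TW k) (tower_a TW k) (tower_N TW k) lw rN _ (blkS TW (fL j)).
  by rewrite /err (sideS TW).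
apply: le_trans (ler_distD B _ _) _; exact: lerD.
Qed.

Definition tau k (w : cfg -> bool) : R :=
  block_hits R c0 (Lv k) w / ((s k)%:R * (N k ^ d)%:R).

Let sN_gt0 k : 0 < (s k)%:R * (N k ^ d)%:R :> R.
Proof.
have [b bL] := ex_block TW k.
by rewrite mulr_gt0 // ltr0n ?expn_gt0 ?(side_gt0 TW) // (cardD1 b) bL.
Qed.

Lemma tau01 k w : 0 <= tau k w <= 1.
Proof.
have S0 : 0 <= block_hits R c0 (Lv k) w.
  by apply: sumr_ge0 => b _; apply: sumr_ge0 => i _; exact: ler0n.
rewrite divr_ge0 ?(ltW (sN_gt0 k)) //= ler_pdivrMr ?sN_gt0 // mul1r mulr_natl.
rewrite -sumr_const; apply: ler_sum => b _.
rewrite -[X in (_ ^ X)%N]card_ord -[X in (X ^ _)%N]card_ord -card_ffun -sum1_card natr_sum.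
by apply: ler_sum => i _; rewrite ler_nat leq_b1.
Qed.

Lemma tau_true k : tau k xpredT = 1.
Proof.
rewrite /tau /block_hits (_ : (\sum_(b in _) _) = (s k)%:R * (N k ^ d)%:R).
  by rewrite divff // gt_eqF.
rewrite mulr_natl -sumr_const; apply: eq_bigr => b _.
by rewrite sumr_const card_ffun !card_ord.
Qed.

Definition window_volume k : R := (window_side k ^ d)%:R / (m k ^ d)%:R.

Lemma window_volume_gt0 k : 0 < window_volume k.
Proof. by rewrite divr_gt0 // ltr0n expn_gt0 ?(tower_m TW) // /window_side muln_gt0. Qed.

(** Sum of the constants in [fA] to [fD] of the next proof, those of [fA] and [fB] counted twice:
    [fE] meets them again when the volume filled by sub-blocks is replaced by that of the window. *)
Definition freq_err r : R := (4 * d + 3 + 2 * r * d)%:R.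

Lemma hits_close k r w x : (0 < k)%N -> local r w -> (r.*2 <= N k)%N ->
  tower_shift Lv x ->
  `|hits R (m k) w (window_side k) (fun=> 0%N) x - tau k w * window_volume k| <=
    freq_err r / k%:R * window_volume k.
Proof.
move=> k0 lw rN xX; have := hits_window lw rN xX.
have m0 := tower_m TW k; have N0 := side_gt0 TW k; have N10 := side_gt0 TW k.+1.
set H := hits _ _ _ _ _ _.
have M1 : 1 <= (m k ^ d)%:R :> R by rewrite ler1n expn_gt0 m0.
have kR : 0 < k%:R :> R by rewrite ltr0n.
have k1R : 0 < k.+1%:R :> R by rewrite ltr0n.
have kinv : k.+1%:R^-1 <= k%:R^-1 :> R by rewrite lef_pV2 ?posrE // ler_nat.
have D0 := window_volume_gt0 k.
set p := (m k * l k)%N; set J := window_tiles k.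
pose W : R := (window_side k ^ d)%:R.
have WD : W = window_volume k * (m k ^ d)%:R.
  by rewrite /window_volume divfK // gt_eqF // (lt_le_trans ltr01).
have JN1W : (J ^ d)%:R * (N k.+1 ^ d)%:R <= W.
  by rewrite -natrM -expnMn ler_nat leq_expl // /window_side -/J; nia.
have pNN1 : ((p * N k) ^ d)%:R <= (N k.+1 ^ d)%:R :> R.
  by rewrite ler_nat leq_expl // (sideS TW) /p; nia.
have kM0 : 0 < k%:R * (m k ^ d)%:R :> R by rewrite mulr_gt0 // (lt_le_trans ltr01).
have k1M0 : 0 < k.+1%:R * (m k ^ d)%:R :> R by rewrite mulr_gt0 // (lt_le_trans ltr01).
have M0 : 0 < (m k ^ d)%:R :> R by rewrite (lt_le_trans ltr01).
have j0 : 0 <= (J ^ d)%:R :> R by rewrite ler0n.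
have WK (b : R) c : 0 < c -> W * (b / (c * (m k ^ d)%:R)) = window_volume k * (b / c).
  by move=> c_gt0; rewrite WD; field; rewrite !gt_eqF.
have fA : W - (J ^ d)%:R * (N k.+1 ^ d)%:R <= window_volume k * ((2 * d)%:R / k.+1%:R).
  rewrite -natrM -expnMn; apply: le_trans (cube_shrink R d (v := window_side k) _ _) _.
  - by rewrite /window_side -/J; clear; nia.
  - by rewrite /window_side muln_gt0.
  rewrite -/W -WK // ler_wpM2l ?ler0n // [(2 * d)%N]mulnC natrM -mulrA.
  rewrite ler_wpM2l ?ler0n // ler_pdivrMr; last by rewrite ltr0n /window_side muln_gt0.
  rewrite mulrAC ler_pdivlMr // -!natrM ler_nat /window_side -/J.
  have -> : (J.+1 * (N k.+1).+1 - J * N k.+1 = J + N k.+1 + 1)%N by clear; nia.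
  have h1 : (k.+1 * m k ^ d <= J.+1)%N by rewrite /J /window_tiles.
  have h2 : (k.+1 * m k ^ d <= (N k.+1).+1)%N.
    by apply: leq_trans (leqW (TWN k.+1)); rewrite leq_mul // leq_expl.
  by move: (k.+1 * m k ^ d)%N (N k.+1) h1 h2 => c n; clear; nia.
have fB : (J ^ d)%:R * ((N k.+1 ^ d)%:R - ((p * N k) ^ d)%:R) <= window_volume k * (1 / k.+1%:R).
  apply: le_trans (ler_wpM2l j0 (TWshape k)) _.
  by rewrite -WK // div1r mulrA ler_wpM2r // invr_ge0 ltW.
have jpW : (J ^ d)%:R * ((p * N k) ^ d)%:R <= W.
  by apply: le_trans JN1W; rewrite ler_wpM2l.
have fC : (J ^ d)%:R * ((p ^ d)%:R * ((N k ^ d)%:R - ((N k - r.*2) ^ d)%:R)) <=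
    window_volume k * ((2 * r * d)%:R / k%:R).
  have := cube_shrink R d (leq_subr r.*2 (N k)) N0; rewrite subKn // => h.
  have h2 : (r.*2%:R / (N k)%:R) <= r.*2%:R / (k%:R * (m k ^ d)%:R) :> R.
    by rewrite ler_wpM2l ?ler0n // lef_pV2 ?posrE ?ltr0n // -natrM ler_nat.
  apply: (@le_trans _ _ ((J ^ d)%:R * ((p ^ d)%:R * ((N k ^ d)%:R *
    (d%:R * (r.*2%:R / (k%:R * (m k ^ d)%:R))))))).
    rewrite ler_wpM2l // ler_wpM2l ?ler0n //; apply: le_trans h _.
    by rewrite ler_wpM2l ?ler0n // ler_wpM2l ?ler0n.
  rewrite -WK // mulrA mulrA -(mulrA (J ^ d)%:R) -natrM -expnMn.
  have -> : d%:R * (r.*2%:R / (k%:R * (m k ^ d)%:R)) = (2 * r * d)%:R / (k%:R * (m k ^ d)%:R) :> R.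
    by rewrite mulrA -natrM mulnC mul2n.
  by rewrite ler_wpM2r // divr_ge0 ?ler0n // ltW.
have fD : (J ^ d)%:R * ((e k)%:R * (m k ^ d)%:R * (s k)%:R * (N k ^ d)%:R) <=
    window_volume k * (1 / k.+1%:R).
  have h : (e k)%:R * (m k ^ d)%:R * (s k)%:R <= (p ^ d)%:R / (k.+1%:R * (m k ^ d)%:R) :> R.
    rewrite ler_pdivlMr // -!natrM ler_nat; apply: leq_trans (TWe k).
    by move: (m k ^ d)%N => c; rewrite leq_eqVlt; apply/orP; left; apply/eqP; ring.
  apply: (@le_trans _ _ ((J ^ d)%:R * ((p ^ d)%:R / (k.+1%:R * (m k ^ d)%:R) * (N k ^ d)%:R))).
    by rewrite ler_wpM2l // ler_wpM2r ?ler0n.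
  by rewrite -WK // div1r mulrAC -(natrM _ (p ^ d)) -expnMn mulrA ler_wpM2r // invr_ge0 ltW.
have /andP[tau0 tau1] := tau01 k w.
have zS : (z k)%:R * block_hits R c0 (Lv k) w = tau k w / (m k ^ d)%:R * ((p * N k) ^ d)%:R.
  have -> : block_hits R c0 (Lv k) w = tau k w * ((s k)%:R * (N k ^ d)%:R).
    by rewrite /tau divfK // gt_eqF.
  rewrite /p !expnMn -(tower_z TW k) !natrM; field; exact: lt0r_neq0.
have fE : `|(J ^ d)%:R * ((z k)%:R * block_hits R c0 (Lv k) w) - tau k w * window_volume k| <=
    W - (J ^ d)%:R * ((p * N k) ^ d)%:R.
  have -> : (J ^ d)%:R * ((z k)%:R * block_hits R c0 (Lv k) w) - tau k w * window_volume k =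
    - (tau k w / (m k ^ d)%:R * (W - (J ^ d)%:R * ((p * N k) ^ d)%:R)).
    by rewrite zS WD; field; exact: lt0r_neq0.
  rewrite normrN ger0_norm; last first.
    by apply: mulr_ge0; [exact: divr_ge0 tau0 (ltW M0)|rewrite subr_ge0].
  rewrite ler_piMl ?subr_ge0 // ler_pdivrMr // mul1r (le_trans tau1) //.
rewrite -/p => HJ; apply: le_trans (ler_distD _ _ _) _; apply: le_trans (lerD HJ fE) _.
have -> : freq_err r = (2 * d)%:R + (2 * d)%:R + 1 + 1 + 1 + (2 * r * d)%:R :> R.
  by rewrite /freq_err !natrD !natrM; ring.
rewrite expnMn natrM -/W.
have D1 (b : R) : 0 <= b -> window_volume k * (b / k.+1%:R) <= b / k%:R * window_volume k.
  by move=> b0; rewrite mulrC ler_wpM2r ?(ltW D0) // ler_wpM2l.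
have := D1 1 ler01; have := D1 _ (ler0n R (2 * d)); move: fA fB fC fD.
rewrite !mulrDl mulrC [(2 * r * d)%:R / _ * _]mulrC.
move: (window_volume k * ((2 * r * d)%:R / k%:R)) => g1.
move: (window_volume k * (1 / k.+1%:R)) (window_volume k * ((2 * d)%:R / k.+1%:R)) => g2 g3.
move: ((2 * d)%:R / k%:R * window_volume k) (1 / k%:R * window_volume k) => g4 g5.
move: (J ^ d)%:R (N k.+1 ^ d)%:R ((p * N k) ^ d)%:R => j n1 pn.
move: ((p ^ d)%:R * _) ((e k)%:R * _ * _ * _) (W) => u v W'.
lra.
Qed.

(** The always true event yields the number of lattice points in the window. By the bound 1 / 2 it
    is at least half of [window_volume k], so two errors relative to the volume become a factor
    4. *)
Lemma avg_close k r w x : (0 < k)%N -> local r w -> (r.*2 <= N k)%N ->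
  freq_err r / k%:R <= 1 / 2 -> tower_shift Lv x ->
  (0 < size (avg_set k))%N /\ `|avg k w x - tau k w| <= 4 * (freq_err r / k%:R).
Proof.
move=> k0 lw rN small xX; have H := hits_close k0 lw rN xX.
have trivl : local r (xpredT : cfg -> bool) by [].
have H1 : `|(size (avg_set k))%:R - window_volume k| <= freq_err r / k%:R * window_volume k.
  have := hits_close k0 trivl rN xX; rewrite tau_true mul1r.
  by rewrite hits_avg_set -sum1_size natr_sum.
have D0 := window_volume_gt0 k; have /andP[t0 t1] := tau01 k w.
move: H H1; rewrite hits_avg_set /avg; move: (\sum_(g <- _) _) => H.
have dsc0 : 0 <= freq_err r / k%:R by rewrite divr_ge0 ?ler0n.
move: (freq_err r / k%:R) (tau k w) (window_volume k) D0 t0 t1 small dsc0.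
move=> e' t D D0 t0 t1 small e0.
set n := size _; rewrite !ler_norml => /andP[h1 h2] /andP[h3 h4].
have eD : e' * D <= D / 2 by rewrite mulrC ler_wpM2l ?(ltW D0) // -div1r.
have n0 : 0 < n%:R :> R by lra.
split; first by rewrite -(ltr0n R).
have -> : H / n%:R - t = (H - t * n%:R) / n%:R by rewrite mulrBl mulfK // gt_eqF.
rewrite ler_pdivlMr // ler_pdivrMr //.
have e1 : e' * D <= 2 * (e' * n%:R) by rewrite mulrCA ler_wpM2l //; lra.
have e2 : t * (D - n%:R) <= e' * D.
  apply: le_trans (_ : t * (e' * D) <= _); first by rewrite ler_wpM2l //; lra.
  by rewrite ler_piMl // mulr_ge0 // ltW.
have e3 : - (e' * D) <= t * (D - n%:R).
  apply: le_trans (_ : t * - (e' * D) <= _); last by rewrite ler_wpM2l //; lra.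
  by rewrite mulrN lerN2 ler_piMl // mulr_ge0 // ltW.
apply/andP; split; lra.
Qed.

Lemma sum_close (T : Type) (r : seq T) (F : T -> R) (c e' : R) :
  (forall t, `|F t - c| <= e') -> `|\sum_(t <- r) F t - (size r)%:R * c| <= (size r)%:R * e'.
Proof.
move=> Fc; rewrite -sum1_size natr_sum !mulr_suml -sumrB.
by apply: le_trans (ler_norm_sum _ _ _) _; apply: ler_sum => t _; rewrite !mul1r.
Qed.

Lemma ex_tower_shift : exists x, tower_shift Lv x.
Proof.
have [y yb] := ex_blk TW 0.
have [|x [xX _ _]] := ex_point TW (k := 0) (v := 0) (Y := y) (fun=> c0).
  by rewrite shift0.
by exists x.
Qed.

Definition freq_rank r := (r.*2 + (4 * d + 3 + 2 * r * d).*2).+1.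

Lemma freq_rankP k r : (freq_rank r <= k)%N ->
  [/\ (0 < k)%N, (r.*2 <= N k)%N & freq_err r / k%:R <= 1 / 2].
Proof.
rewrite /freq_rank => rk; have k0 : (0 < k)%N by lia.
have M0 : (0 < m k ^ d)%N by rewrite expn_gt0 (tower_m TW).
split=> //; first by apply: leq_trans (TWN k); nia.
rewrite /freq_err ler_pdivrMr ?ltr0n // mulrC mulrA ler_pdivlMr // mulr1 -natrM ler_nat; lia.
Qed.

(** Sum [w] over the translates of [x] by g + h, with g in the window of level [k] and h in that of
    level [k']. One order of summation gives nearly [tau k], the other nearly [tau k']. *)
Lemma tau_close k k' r w : (freq_rank r <= k)%N -> (freq_rank r <= k')%N -> local r w ->
  `|tau k w - tau k' w| <= 4 * (freq_err r / k%:R) + 4 * (freq_err r / k'%:R).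
Proof.
move=> rk rk' lw; have [x xX] := ex_tower_shift.
have [k0 rN sm] := freq_rankP rk; have [k0' rN' sm'] := freq_rankP rk'.
have S := fun g => avg_close k0 lw rN sm (tower_shift_invariant g xX).
have S' := fun g => avg_close k0' lw rN' sm' (tower_shift_invariant g xX).
have n0 : 0 < (size (avg_set k))%:R :> R by rewrite ltr0n; have [] := S 0.
have n0' : 0 < (size (avg_set k'))%:R :> R by rewrite ltr0n; have [] := S' 0.
have := sum_close (avg_set k) (fun g => (S' g).2).
have := sum_close (avg_set k') (fun g => (S g).2).
rewrite /avg -!mulr_suml exchange_big /=.
have -> : \sum_(j <- avg_set k) \sum_(i <- avg_set k') (w (shift j (shift i x)))%:R =
  \sum_(j <- avg_set k) \sum_(i <- avg_set k') (w (shift i (shift j x)))%:R :> R.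
  by apply: eq_bigr => g _; apply: eq_bigr => h _; rewrite -!shiftD addrC.
move: (\sum_(j <- _) _) => A.
move: (size (avg_set k))%:R (size (avg_set k'))%:R n0 n0' => n n' n0 n0'.
move=> H H'; have nn : 0 < n * n' by exact: mulr_gt0.
have G : `|A - n * n' * tau k w| <= n * n' * (4 * (freq_err r / k%:R)).
  have -> : A - n * n' * tau k w = n * (A / n - n' * tau k w).
    by field; exact: lt0r_neq0.
  by rewrite normrM (gtr0_norm n0) -mulrA ler_wpM2l // ltW.
have G' : `|A - n * n' * tau k' w| <= n * n' * (4 * (freq_err r / k'%:R)).
  have -> : A - n * n' * tau k' w = n' * (A / n' - n * tau k' w).
    by field; exact: lt0r_neq0.
  by rewrite normrM (gtr0_norm n0') [n * n']mulrC -mulrA ler_wpM2l // ltW.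
rewrite -(ler_pM2l nn) -{1}(gtr0_norm nn) -normrM mulrBr mulrDr.
by apply: le_trans (ler_distD A _ _) _; rewrite distrC lerD.
Qed.

Theorem unif_freq r (w : cfg -> bool) : local r w ->
  exists t : R, forall e', 0 < e' -> exists k0, forall k, (k0 <= k)%N ->
    (0 < size (avg_set k))%N /\ forall x, tower_shift Lv x -> `|avg k w x - t| <= e'.
Proof.
move=> lw; have rank e' : 0 < e' -> exists k0, (freq_rank r <= k0)%N /\
    forall k, (k0 <= k)%N -> 4 * (freq_err r / k%:R) <= e' / 4.
  move=> e0; exists (freq_rank r + Num.truncn (16 * freq_err r / e'))%N.+1; split; first lia.
  move=> k kk; have k0 : 0 < k%:R :> R by rewrite ltr0n; lia.
  rewrite mulrA ler_pdivrMr // mulrAC ler_pdivlMr // mulrC -ler_pdivrMl //.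
  apply: ltW; apply: lt_le_trans (_ : (Num.truncn (16 * freq_err r / e')).+1%:R <= _).
    apply: le_lt_trans (truncnS_gt _); rewrite le_eqVlt; apply/orP; left; apply/eqP; ring.
  by rewrite ler_nat; lia.
have cau : cauchy ((fun k => tau k w) @ \oo).
  apply: cauchy_exP => e' e0; have [k0 [rk0 H]] := rank _ e0.
  exists (tau k0 w); exists k0 => // k /= kk; rewrite -ball_normE /=.
  have := tau_close rk0 (leq_trans rk0 kk) lw; have := H _ kk; have := H _ (leqnn k0); lra.
have /cauchy_cvg/cvg_ex[/= t tP] := cau.
exists t => e' e0; have [k1 [rk1 H]] := rank _ e0.
have e4 : 0 < e' / 4 by rewrite divr_gt0.
have /cvgrPdist_le/(_ _ e4)[k2 _ K2] := tP.
exists (k1 + k2)%N => k kk; have rk : (freq_rank r <= k)%N by lia.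
have [k0 rN sm] := freq_rankP rk.
split; first by have [x0 x0X] := ex_tower_shift; have [] := avg_close k0 lw rN sm x0X.
move=> x xX; have [_ A] := avg_close k0 lw rN sm xX.
have k1k : (k1 <= k)%N by lia.
have /= := K2 k _; rewrite /= => /(_ (leq_trans (leq_addl _ _) kk)) B.
apply: le_trans (ler_distD (tau k w) _ _) _; have := H k k1k.
by move: A B; rewrite (distrC t); lra.
Qed.

End frequency.

(** * Choice of the parameters *)

(** Induction, from n ln (1 + 1 / n) <= 1. *)
Lemma ln_fact (R : realType) n : n%:R * (ln n%:R - 1) <= ln n`!%:R :> R.
Proof.
elim: n => [|n IH]; first by rewrite mul0r ln1.
have [->|n0] := posnP n; first by rewrite ln1 sub0r mul1r oppr_le0 ler01.
have nR : 0 < n%:R :> R by rewrite ltr0n.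
have step : n%:R * (ln n.+1%:R - ln n%:R) <= 1 :> R.
  rewrite -ln_div ?posrE ?ltr0n // mulrC -ler_pdivlMr //.
  have -> : n.+1%:R / n%:R = 1 + n%:R^-1 :> R by rewrite -natr1 mulrDl divff ?gt_eqF // mul1r.
  by rewrite mul1r le_ln1Dx // (lt_trans _ (_ : 0 < n%:R^-1)) ?invr_gt0 // ltrN10.
rewrite factS natrM lnM ?posrE ?ltr0n ?fact_gt0 //.
move: IH step; rewrite -!natr1; move: (ln (n%:R + 1)) (ln n%:R) (ln n`!%:R) => u v w; nra.
Qed.

Section density.
Variables (R : realType) (d : nat).
Local Notation V := 'rV[int]_d.

(** The limsup is specialised to cubes; the supremum over positions makes [n0] independent of
    [v]. *)
Lemma density0_count (P : set V) : upper_banach_density R P = 0%E ->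
  forall e : R, 0 < e -> exists n0, forall n (v : V), (n0 <= n)%N -> (0 < n)%N ->
    #|[pred i : cube d n | `[< P (v + cell i)%R >]]|%:R <= e * (n ^ d)%:R.
Proof.
rewrite /upper_banach_density /limf_esup => inf0 e e0.
have [_ [W [N _ NW] <-] We] : exists2 x, [set ereal_sup [set (ereal_sup
      [set ((#|` fset_set (P `&` box r n)|)%:R
        / (\prod_(i < d) n ord0 i)%N%:R : R)%:E | r in [set: V]])
      | n in W] | W in @all_infty d] x & (x < e%:E)%E.
  by apply: ereal_inf_lt; rewrite inf0 lte_fin.
exists N => n v Nn n0.
have prodE : (\prod_(i < d) (const_mx n : 'rV[nat]_d) ord0 i = n ^ d)%N.
  by rewrite (eq_bigr (fun=> n)) ?prod_nat_const ?card_ord // => i _; rewrite mxE.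
have nd0 : 0 < (n ^ d)%:R :> R by rewrite ltr0n expn_gt0 n0.
have cnt : (#|[pred i : cube d n | `[< P (v + cell i)%R >]]| <=
    #|` fset_set (P `&` box v (const_mx n))|)%N.
  have fin : finite_set (P `&` box v (const_mx n)).
    apply: (sub_finite_set (B := [set v + cell i | i in [set: cube d n]])) => [g [_ /boxP[i ->]]|].
      by exists i.
    by apply: finite_image; exact: finite_finset.
  rewrite cardE -(size_map (fun i => v + cell i)); apply: uniq_leq_size.
    by rewrite map_inj_uniq ?enum_uniq // => i j /addrI/cell_inj.
  move=> _ /mapP[i iP ->]; rewrite in_fset_set // inE /=; split.
    by move: iP; rewrite mem_enum inE.
  by apply/boxP; exists i.
have : (((#|` fset_set (P `&` box v (const_mx n))|)%:R / (n ^ d)%:R : R)%:E <= e%:E)%E.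
  apply: le_trans (ltW We); rewrite -prodE.
  apply: (@le_trans _ _ (ereal_sup [set ((#|` fset_set (P `&` box r (const_mx n))|)%:R
    / (\prod_(i < d) (const_mx n : 'rV[nat]_d) ord0 i)%N%:R : R)%:E | r in [set: V]])).
    by apply: ereal_sup_ubound; exists v; rewrite // prodE.
  by apply: ereal_sup_ubound; exists (const_mx n) => //; apply: NW => i; rewrite mxE.
rewrite lee_fin ler_pdivrMr //; apply: le_trans; by rewrite ler_nat.
Qed.

End density.

Section existence.
Variables (R : realType) (d : nat) (C : finType) (c0 : C).
Local Notation V := 'rV[int]_d.
Variables (P : set V) (M : R).
Hypotheses (d_gt0 : (0 < d)%N) (P0 : upper_banach_density R P = 0%E) (M_ge0 : 0 <= M).

(* The decreasing term absorbs the loss of entropy per cell at level [k], which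
   is at most [2 ^- k] plus an arbitrarily small amount. *)
Definition entropy_rate k : R := M + 4 / 2 ^+ k.

(** [inv_large] serves twice: k k!^d makes borders negligible against the lattice, and 2^k turns an
    entropy loss of 1 per block into at most 2^-k per cell. *)
Record level_inv k (L : level d C) : Prop := LevelInv {
  inv_side : (0 < side L)%N;
  inv_mod : side L = 1 %[mod k`!];
  inv_large : (k * k`! ^ d + 2 ^ k <= side L)%N;
  inv_blocks : (0 < #|blocks L|)%N;
  inv_entropy : entropy_rate k * (side L ^ d)%:R <= ln #|blocks L|%:R
}.

Record good_step k (L L' : level d C) (l e z : nat) : Prop := GoodStep {
  step_next : L' = next c0 L k.+1`! (k`! * l) k`! e z;
  step_z : (z * #|blocks L| = l ^ d)%N;
  step_e : (e < z)%N;
  step_q : (2 < k.+1`! + k`! * l)%N;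
  step_l : (0 < l)%N;
  step_P : forall v : V, (#|[pred i : cube d (side L') | `[< P (v + cell i)%R >]]| < e)%N;
  step_shape : (side L' ^ d)%:R - ((k`! * l * side L) ^ d)%:R <=
    (side L' ^ d)%:R / (k.+1%:R * (k`! ^ d)%:R) :> R;
  step_err : (k.+1 * e * k`! ^ d * k`! ^ d * #|blocks L| <= (k`! * l) ^ d)%N
}.

Lemma ex_good_step k L : level_inv k L ->
  exists L' l e z, good_step k L L' l e z /\ level_inv k.+1 L'.
Proof.
move=> [N0 Nm Nl s0 Ns].
set N := side L in N0 Nm Nl Ns *; set s := #|blocks L| in s0 Ns *.
set m := k`! in Nm Nl *; have m0 : (0 < m)%N by exact: fact_gt0.
pose a := k.+1`!; have a0 : (0 < a)%N by exact: fact_gt0.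
have aE : a = (m * k.+1)%N by rewrite /a factS mulnC.
(* A share 1 / K of the sites is left free, as [step_err] permits; the factor 4 also gives [e < z]
   when k = 0. *)
have [K KE] : {K | K = (4 * k.+1 * m ^ d * m ^ d * s)%N} by eexists.
have md0 : (0 < m ^ d)%N by rewrite expn_gt0 m0.
have K0 : (0 < K)%N by rewrite KE !muln_gt0 md0 s0.
have K0R : 0 < K%:R :> R by rewrite ltr0n.
(* Bound for the relative volume outside the counted sites: the factor 2^-k / (M + 3) is for the
   entropy, the rest for [step_shape]. *)
pose eta : R := 2 ^- k / (M + 3) / (k.+1%:R * (m ^ d)%:R).
have M0 : 0 <= M := M_ge0; have M3 : 0 < M + 3 by rewrite ltr_wpDl.
have k2 : 0 < 2 ^- k :> R by rewrite invr_gt0 exprn_gt0.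
have km0 : 1 <= k.+1%:R * (m ^ d)%:R :> R by rewrite -natrM ler1n muln_gt0.
have eta0 : 0 < eta by rewrite !divr_gt0 // (lt_le_trans ltr01 km0).
(* At this density at most p^d / (2 K) cells of the new block lie in [P], its side being at most 2 p
   N. *)
have sig0 : 0 < (2 * K * (2 * N) ^ d)%N%:R^-1 :> R.
  by rewrite invr_gt0 ltr0n !muln_gt0 K0 expn_gt0 muln_gt0 N0.
have [n0 n0P] := density0_count P0 sig0.
have [t tE] : {t | t = Num.truncn (d%:R * (a * N + 1)%N%:R / eta)} by eexists.
(* The blocks have to be large for the density of [P] to be small in them, for
   the layer of extra cells to be negligible, and for the next level. *)
have [lam lamE] : {lam | lam = 3 + n0 + 2 * K + (k.+1 * a ^ d + 2 ^ k.+1) + t}%N by eexists.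
(* The factor k+1 makes [p] a multiple of [a], so that the new side is 1 modulo (k+1)!; the factor
   [s] makes l^d divisible by [s]. *)
pose l := (k.+1 * s * lam)%N.
pose p := (m * l)%N.
have pE : p = (a * s * lam)%N by rewrite /p /l aE; ring.
pose z := ((k.+1 * lam) ^ d * s ^ d.-1)%N.
pose e := (p ^ d %/ K)%N.
pose L' := next c0 L a p m e z.
have N'E : side L' = ((a + p) * N).+1 by [].
have lam3 : (3 <= lam)%N by rewrite lamE -!addnA leq_addr.
have lam0 : (0 < lam)%N by exact: leq_trans lam3.
have lamp : (lam <= p)%N by rewrite pE leq_pmull // muln_gt0 a0.
have l0 : (0 < l)%N by rewrite /l !muln_gt0 s0 lam0.
have zE : (z * s = l ^ d)%N.
  rewrite /z /l -mulnA -expnSr prednK // -expnMn; congr (_ ^ _)%N; ring.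
have pd : (p ^ d = m ^ d * (z * s))%N by rewrite zE -expnMn.
have ppd : (p <= p ^ d)%N.
  by rewrite -(prednK d_gt0) expnS leq_pmulr // expn_gt0 (leq_trans lam0 lamp).
have eK : (e * K <= p ^ d)%N by exact: leq_trunc_div.
have ez : (e < z)%N.
  rewrite -(ltn_pmul2r K0); apply: leq_ltn_trans eK _; rewrite pd KE.
  have z0 : (0 < z)%N by rewrite /z muln_gt0 !expn_gt0 muln_gt0 s0 lam0.
  have -> : (z * (4 * k.+1 * m ^ d * m ^ d * s) = (m ^ d * (z * s)) * (4 * k.+1 * m ^ d))%N by ring.
  apply: ltn_Pmulr; last by rewrite (muln_gt0 (m ^ d)) md0 (muln_gt0 z) z0 s0.
  by apply: leq_trans (leq_pmulr _ md0); clear; lia.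
have lamN' : (lam <= side L')%N.
  by apply: leq_trans lamp _; rewrite N'E; move: N0; clear; nia.
have N'2 : (side L' <= 2 * (p * N))%N.
  rewrite N'E pE; have : (a * N + 1 <= a * s * lam * N)%N.
    apply: (@leq_trans (a * N * 2)); first by move: a0 N0; clear; nia.
    rewrite [X in (_ <= X)%N](_ : _ = (a * N) * (s * lam))%N; last by ring.
    by rewrite leq_mul //; move: s0 lam3; clear; nia.
  by move: (a * s * lam)%N => u; clear; nia.
have pNN' : (p * N <= side L')%N by rewrite N'E; clear; nia.
have N'0 : (0 < side L')%N by rewrite N'E.
have shape : (side L' ^ d)%:R - ((p * N) ^ d)%:R <= (side L' ^ d)%:R * eta :> R.
  apply: le_trans (cube_shrink R d pNN' N'0) _; rewrite ler_wpM2l ?ler0n //.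
  have -> : (side L' - p * N = a * N + 1)%N by rewrite N'E mulnDl; clear; lia.
  rewrite mulrA ler_pdivrMr ?ltr0n // -(ler_pdivrMl _ _ eta0) mulrC.
  apply: ltW; apply: lt_le_trans (truncnS_gt _) _; rewrite -tE ler_nat.
  by apply: leq_trans lamN'; rewrite lamE; clear; lia.
have eta_le : eta <= (k.+1%:R * (m ^ d)%:R)^-1.
  rewrite /eta ler_piMl ?invr_ge0 ?(le_trans ler01 km0) //.
  rewrite ler_pdivrMr // mul1r; have : 2 ^- k <= 1 :> R.
    by rewrite invf_le1 ?exprn_gt0 // exprn_ege1 // ler1n.
  by lra.
have eta_le2 : eta <= 2 ^- k / (M + 3).
  by rewrite /eta ler_pdivrMr ?(lt_le_trans ltr01 km0) // ler_peMr // ltW // divr_gt0.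
have gs : good_step k L L' l e z.
  split=> //.
  - by change (2 < a + p)%N; move: a0 (leq_trans lam3 lamp); clear; lia.
  - move=> v; have := n0P (side L') v; rewrite N'0 => /(_ _ isT) H.
    have {}H := H (leq_trans (_ : (n0 <= lam)%N) lamN').
    rewrite -(ltr_nat R); apply: le_lt_trans (H _) _; first by rewrite lamE; clear; lia.
    have : (side L' ^ d)%:R <= ((2 * N) ^ d)%:R * (p ^ d)%:R :> R.
      rewrite -natrM ler_nat -expnMn; apply: leq_expl; apply: leq_trans N'2 _.
      by rewrite leq_eqVlt; apply/orP; left; apply/eqP; ring.
    move=> h; apply: (@le_lt_trans _ _ ((p ^ d)%:R / (2 * K)%:R)).
      have KN0 : (0 < 2 * K * (2 * N) ^ d)%N by rewrite !muln_gt0 K0 expn_gt0 muln_gt0 N0.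
      rewrite ler_pdivrMl ?ltr0n //; apply: le_trans h _.
      have : 0 < (2 * K)%:R :> R by rewrite ltr0n muln_gt0.
      rewrite (natrM _ (2 * K)); move: (2 * K)%:R (_ ^ d)%:R (p ^ d)%:R => u x y u0.
      by rewrite le_eqVlt; apply/orP; left; apply/eqP; field; exact: lt0r_neq0.
    rewrite ltr_pdivrMr ?ltr0n ?muln_gt0 // -natrM ltr_nat.
    (* Rounding is harmless: [e] exceeds p^d / K - 1, which is at least p^d / (2 K) once p^d >= 2
       K. *)
    have := divn_eq (p ^ d) K; have := ltn_pmod (p ^ d) K0; rewrite /e.
    have : (2 * K <= p ^ d)%N.
      by apply: leq_trans ppd; apply: leq_trans lamp; rewrite lamE; clear; lia.
    by move: (p ^ d)%N (p ^ d %% K)%N (p ^ d %/ K)%N => x y e'; clear; nia.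
  - by rewrite -/p -/m -/N; apply: le_trans shape _; rewrite ler_wpM2l ?ler0n.
  - rewrite -/p -/m -/s; apply: leq_trans eK; rewrite KE.
    have -> : (e * (4 * k.+1 * m ^ d * m ^ d * s) = 4 * (k.+1 * e * m ^ d * m ^ d * s))%N by ring.
    by rewrite leq_pmull.
exists L', l, e, z; split=> //; split=> //.
- rewrite N'E pE -/a; have -> : ((a + a * s * lam) * N = (1 + s * lam) * N * a)%N by ring.
  by rewrite -addn1 modnMDl.
- by apply: leq_trans lamN'; rewrite lamE -/a; clear; lia.
- have [b bL] : exists b, b \in blocks L by move: s0; rewrite /s card_gt0 => /set0Pn.
  have := card_blocks_next c0 a e m0 zE bL; apply: leq_trans.
  by rewrite expn_gt0 fact_gt0.
- have [b bL] : exists b, b \in blocks L by move: s0; rewrite /s card_gt0 => /set0Pn.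
  have cb := card_blocks_next c0 a e m0 zE bL.
  have f0 : (0 < s`!)%N by exact: fact_gt0.
  have : ln ((s`! ^ (z * m ^ d))%N%:R) <= ln #|blocks L'|%:R :> R.
    rewrite ler_ln ?posrE ?ltr0n ?expn_gt0 ?f0 // ?ler_nat //.
    by apply: leq_trans cb; rewrite expn_gt0 f0.
  apply: le_trans; rewrite (natrX _ s`!) lnXn ?ltr0n // -[leRHS]mulr_natr.
  apply: (@le_trans _ _ ((p ^ d)%:R * (ln s%:R - 1))); last first.
    have := ln_fact R s; have : 0 <= (z * m ^ d)%N%:R :> R by rewrite ler0n.
    move=> z0 h; apply: le_trans (ler_wpM2r z0 h).
    by rewrite le_eqVlt; apply/orP; left; apply/eqP; rewrite pd !natrM; ring.
  (* The loss of 1 per site, at most 2^-k per cell, turns the coefficient 4 of 2^-k into 3; spacers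
     and uncounted sites turn 3 into 2, which is the rate at level k+1. *)
  apply: (@le_trans _ _ (((p * N) ^ d)%:R * (M + 3 * 2 ^- k))); last first.
    rewrite expnMn natrM -mulrA ler_wpM2l ?ler0n //.
    have N2 : 1 <= (N ^ d)%:R * 2 ^- k :> R.
      rewrite ler_pdivlMr ?exprn_gt0 // mul1r -natrX ler_nat.
      apply: (@leq_trans N); first by apply: leq_trans Nl; exact: leq_addl.
      by rewrite -(prednK d_gt0) expnS leq_pmulr // expn_gt0 N0.
    move: Ns; rewrite /entropy_rate; move: (_ ^- k) (ln _) N2 => g u; nra.
  have -> : entropy_rate k.+1 = M + 2 * 2 ^- k.
    by rewrite /entropy_rate exprS; field; rewrite expf_neq0.
  have g1 : 2 ^- k <= 1 :> R by rewrite invf_le1 ?exprn_gt0 // exprn_ege1 // ler1n.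
  move: shape g1 eta_le2 k2.
  move: ((p * N) ^ d)%:R (side L' ^ d)%:R (ler0n R (side L' ^ d)) => x y y0.
  rewrite -/N; move: (2 ^- k) => g xy g1 ele g0.
  have h1 : y - x <= y * (g / (M + 3)) by apply: le_trans xy _; rewrite ler_wpM2l.
  have h2 : (y - x) * (M + 3 * g) <= y * g.
    apply: (@le_trans _ _ (y * (g / (M + 3)) * (M + 3 * g))).
      by rewrite ler_wpM2r //; nra.
    rewrite -mulrA ler_wpM2l // mulrAC ler_pdivrMr //; nra.
  nra.
Qed.

(** A block of level 0 is a single letter, so the hypothesis is the entropy bound at level 0. *)
Lemma ex_tower : M + 4 <= ln #|C|%:R ->
  exists Lv l e z, [/\ tower c0 P Lv (fun k => k.+1`!) factorial l e z,
    forall k, level_inv k (Lv k) &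
    forall k, good_step k (Lv k) (Lv k.+1) (l k) (e k) (z k)].
Proof.
move=> MC.
have /choice[f fP] : forall kL : nat * level d C, exists w : level d C * (nat * nat * nat),
    level_inv kL.1 kL.2 ->
    good_step kL.1 kL.2 w.1 w.2.1.1 w.2.1.2 w.2.2 /\ level_inv kL.1.+1 w.1.
  move=> [k L] /=; have [inv|ninv] := pselect (level_inv k L).
    by have [L' [l [e [z ?]]]] := ex_good_step inv; exists (L', (l, e, z)).
  by exists (L, (0, 0, 0))%N.
pose L0 : level d C := @Level d C 1 [set: _]%SET.
pose Lv := fix Lv k := if k is k'.+1 then (f (k', Lv k')).1 else L0.
have inv k : level_inv k (Lv k).
  elim: k => [|k IH]; last by have [] := fP (k, Lv k) IH.
  split=> //=; rewrite ?cardsT.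
  - by rewrite card_ffun expn_gt0; apply/orP; left; apply/card_gt0P; exists c0.
  - by rewrite card_ffun card_ffun !card_ord exp1n expn1 /entropy_rate expr0 divr1 mulr1.
have good k := (fP (k, Lv k) (inv k)).1.
exists Lv, (fun k => (f (k, Lv k)).2.1.1), (fun k => (f (k, Lv k)).2.1.2),
  (fun k => (f (k, Lv k)).2.2).
split=> //; split=> //.
- by move=> k; case: (good k).
- by move=> k; exact: fact_gt0.
- by move=> k; case: (good k).
- by move=> k; case: (good k).
- by move=> k; case: (good k).
- by move=> k; exact: fact_gt0.
- by move=> k; case: (good k).
- by move=> k; rewrite factS dvdn_mull.
- by move=> k; case: (inv k).
- by move=> k; case: (good k).
Qed.

End existence.

(** * Subshifts as metric spaces *)

Section subshift.
Variables (d : nat) (C : finType).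
Local Notation V := 'rV[int]_d.
Local Notation cfg := (V -> C).

Lemma agree_le r r' (x y : cfg) : (r <= r')%N -> agree r' x y -> agree r x y.
Proof.
move=> rr xy g rg; apply: xy => i; have := rg i.
by move: (g _ _) => u /andP[? ?]; apply/andP; split; lia.
Qed.

Lemma agree_sym r (x y : cfg) : agree r x y -> agree r y x.
Proof. by move=> xy g /xy ->. Qed.

Lemma agree_trans r (x y w : cfg) : agree r x y -> agree r y w -> agree r x w.
Proof. by move=> xy yw g gr; rewrite xy ?yw. Qed.

Lemma sym_cube_norm (g : V) : sym_cube (\sum_i `|g ord0 i|).+1%N g.
Proof.
move=> i; rewrite (bigD1 i) //=; move: (\sum_(j | _) _)%N (g _ _) => n u.
by apply/andP; split; lia.
Qed.

Lemma agree_all (x y : cfg) : (forall r, agree r x y) -> x = y.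
Proof. by move=> xy; apply/funext => g; exact: (xy _ _ (sym_cube_norm g)). Qed.

(* [z] only serves to make the type pointed, and [R] to fix the field in which
   distances live. *)
Definition subshift (R : realType) (S : set cfg) (z : cfg) (Sz : S z) : Type :=
  {x : cfg | S x}.

Variables (R : realType) (S : set cfg) (z : cfg) (Sz : S z).
Local Notation X := (subshift R Sz).

Definition config (x : X) : cfg := proj1_sig x.

Lemma config_inj (x y : X) : config x = config y -> x = y.
Proof. by case: x y => [x xS] [y yS] /= xy; subst y; congr exist; exact: Prop_irrelevance. Qed.

HB.instance Definition _ := gen_eqMixin X.
HB.instance Definition _ := gen_choiceMixin X.
HB.instance Definition _ := isPointed.Build X (exist _ z Sz).

(* The inverse of the least radius at which [x] and [y] disagree, an
   ultrametric. *)
Definition sdist (x y : X) : R :=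
  match pselect (exists r, `[< ~ agree r.+1 (config x) (config y) >]) with
  | left E => (ex_minn E).+1%:R^-1
  | right _ => 0
  end.

Lemma sdist_lt x y r : (sdist x y < r.+1%:R^-1) <-> agree r.+1 (config x) (config y).
Proof.
rewrite /sdist; case: pselect => [E|nE].
  case: ex_minnP => n /asboolP nn nmin; rewrite ltf_pV2 ?posrE // ltr_nat ltnS.
  split=> [rn|xy].
    have [//|h] := pselect (agree r.+1 (config x) (config y)).
    by have := nmin r (introT (asboolP _) h); rewrite leqNgt rn.
  by rewrite ltnNge; apply/negP => nr; apply: nn; apply: agree_le xy.
split=> [_|_]; last by rewrite invr_gt0.
have [//|h] := pselect (agree r.+1 (config x) (config y)).
by case: nE; exists r; apply/asboolP.
Qed.

Lemma sdist_ge0 x y : 0 <= sdist x y.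
Proof. by rewrite /sdist; case: pselect => // E; rewrite invr_ge0. Qed.

Lemma sdist_le x y e : 0 <= e ->
  (forall r, e < r.+1%:R^-1 -> agree r.+1 (config x) (config y)) -> sdist x y <= e.
Proof.
move=> e0 H; rewrite leNgt; apply/negP; move: (sdist_lt x y); rewrite /sdist.
case: pselect => [E|_]; last by rewrite ltNge e0.
by case: ex_minnP => n /asboolP nn _ _ /H.
Qed.

Lemma sdistxx x : sdist x x = 0.
Proof. by apply/eqP; rewrite eq_le sdist_ge0 andbT sdist_le. Qed.

Lemma sdist_eq0 x y : sdist x y = 0 -> x = y.
Proof.
move=> xy; apply: config_inj; apply: agree_all => r.
by apply: agree_le (leqnSn r) _; apply/sdist_lt; rewrite xy invr_gt0.
Qed.

Lemma sdist_sym x y : sdist x y = sdist y x.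
Proof.
suff H x' y' : sdist x' y' <= sdist y' x' by apply/eqP; rewrite eq_le !H.
by apply: sdist_le => [|r /sdist_lt/agree_sym//]; exact: sdist_ge0.
Qed.

Lemma sdist_triangle y x w : sdist x w <= sdist x y + sdist y w.
Proof.
apply: sdist_le => [|r H]; first by rewrite addr_ge0 ?sdist_ge0.
apply: (agree_trans (y := config y)); apply/sdist_lt; apply: le_lt_trans H.
  by rewrite lerDl sdist_ge0.
by rewrite lerDr sdist_ge0.
Qed.

HB.instance Definition _ := isMetric.Build R X sdistxx sdist_eq0 sdist_sym sdist_triangle.

Lemma ball_agree (x : X) r : ball x (r.+1%:R^-1 : R) = [set y | agree r.+1 (config x) (config y)].
Proof.
rewrite ballEmdist; apply/seteqP; split=> y /=; first exact: (sdist_lt x y r).1.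
exact: (sdist_lt x y r).2.
Qed.

Lemma nbhs_agree (x : X) (A : set X) :
  nbhs x A <-> exists r, forall y, agree r (config x) (config y) -> A y.
Proof.
split=> [/nbhs_ballP[e /= e0 eA]|[r rA]].
  exists (Num.truncn e^-1).+1 => y xy; apply: eA.
  suff : ball x ((Num.truncn e^-1).+1%:R^-1 : R) y.
    apply: le_ball; rewrite -[leRHS]invrK lef_pV2 ?posrE ?invr_gt0 //.
    by rewrite ltW // truncnS_gt.
  by rewrite ball_agree.
apply/nbhs_ballP; exists r.+1%:R^-1; first by rewrite /= invr_gt0.
by rewrite ball_agree => y /(agree_le (leqnSn r)); exact: rA.
Qed.

Definition locset r (A : set X) := forall x y, agree r (config x) (config y) -> A x -> A y.

Lemma locset_open r A : locset r A -> open A.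
Proof.
by move=> lA; rewrite openE => x Ax; apply/nbhs_agree; exists r => y /lA; apply.
Qed.

Lemma locsetC r A : locset r A -> locset r (~` A).
Proof. by move=> lA x y xy nAx Ay; apply: nAx; apply: lA (agree_sym xy) Ay. Qed.

Lemma locset_closed r A : locset r A -> closed A.
Proof. by move=> /locsetC/locset_open; rewrite openC. Qed.

(** Take the points whose cylinder of radius [r] lies in [U]. As the union is countable, cylinders
    generate the Borel sets. *)
Lemma open_bigcup_locset (U : set X) : open U ->
  exists2 F : nat -> set X, forall r, locset r (F r) & U = \bigcup_r F r.
Proof.
move=> oU; exists (fun r => [set x | forall y, agree r (config x) (config y) -> U y]).
  by move=> r x y xy Fx w yw; apply: Fx; exact: agree_trans yw.
apply/seteqP; split=> [x Ux|x [r _]]; last by apply=> g.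
by move: oU; rewrite openE => /(_ x Ux)/nbhs_agree[r rU]; exists r.
Qed.

Hypothesis Sclosed : forall x, (forall r, exists2 y, S y & agree r x y) -> S x.

(** Along an ultrafilter each coordinate settles on one letter, [C] being finite; the limit
    configuration is in [S] by [Sclosed]. *)
Lemma subshift_compact : compact [set: X].
Proof.
rewrite compact_ultra => F FU _.
have pick g : exists c : C, F [set x : X | config x g = c].
  apply: contrapT => nF.
  suff : F set0 by exact: filter_not_empty.
  have /filter_forall H : forall c : C, F [set x : X | config x g <> c].
    move=> c; have [Fc|//] := in_ultra_setVsetC [set x : X | config x g = c] FU.
    by case: nF; exists c.
  by apply: filterS H => x /(_ (config x g)).
have [y yP] := choice pick.
have yr r : F [set x : X | agree r y (config x)].
  pose cr (i : cube d r.*2) : V := cell i - vec (fun=> r).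
  have /filter_forall H : forall i, F [set x : X | config x (cr i) = y (cr i)].
    by move=> i; exact: yP.
  apply: filterS H => x xy g gr; suff [i ->] : exists i, g = cr i by rewrite xy.
  suff /box0P[i E] : box 0 (const_mx r.*2) (g + vec (fun=> r)).
    by exists i; rewrite /cr -E addrK.
  move=> i; have := gr i; rewrite !mxE; move: (g _ _) => u /andP[? ?].
  by apply/andP; split; lia.
have Sy : S y.
  apply: Sclosed => r; have /filter_ex[x xr] := yr r.
  by exists (config x) => //; case: x {xr}.
exists (exist _ y Sy); split=> // A /nbhs_agree[r rA].
by apply: filterS (yr r) => x; exact: rA.
Qed.

End subshift.

(** * The invariant measure given by frequencies *)

Section action.
Variables (d : nat) (C : finType) (R : realType).
Local Notation V := 'rV[int]_d.
Local Notation cfg := (V -> C).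
Variables (S : set cfg) (z : cfg) (Sz : S z).
Hypothesis Sinv : forall g x, S x -> S (shift g x).
Local Notation X := (subshift R Sz).

Definition act (g : V) (x : X) : X := exist _ (shift g (config x)) (Sinv g (proj2_sig x)).

Lemma config_act g x : config (act g x) = shift g (config x).
Proof. by []. Qed.

Lemma act0 x : act 0 x = x.
Proof. by apply: config_inj; rewrite config_act shift0. Qed.

Lemma actD g h x : act (g + h) x = act g (act h x).
Proof. by apply: config_inj; rewrite !config_act -shiftD addrC. Qed.

Lemma agree_shift g : exists n, forall r (x y : cfg),
  agree (r + n) x y -> agree r (shift g x) (shift g y).
Proof. by have [n ng] := sym_cubeD g; exists n => r x y xy h /(ng r); exact: xy. Qed.

Lemma act_continuous g : continuous (act g).
Proof.
move=> x A /nbhs_agree[r rA]; apply/nbhs_agree; have [n nP] := agree_shift g.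
by exists (r + n)%N => y xy; apply: rA; exact: nP.
Qed.

Lemma act_continuous_action : continuous_action act.
Proof.
by split; [exact: act0|move=> g h x; exact: actD|exact: act_continuous].
Qed.

Lemma locset_act g r A : locset r A -> exists r', locset r' (act g @^-1` A : set X).
Proof.
move=> lA; have [n nP] := agree_shift g.
by exists (r + n)%N => x y xy; apply: lA; exact: nP.
Qed.

Hypothesis Scl : forall x, (forall r, exists2 y, S y & agree r x y) -> S x.

(** A copy of the space carrying the algebra of cylinders, from which the measure is extended. *)
Definition cylinder_space : Type := X.
HB.instance Definition _ := Pointed.on cylinder_space.
Definition cylinders : set (set cylinder_space) := [set A | exists r, locset r A].

Lemma cylinders0 : cylinders set0.
Proof. by exists 0%N. Qed.

Lemma cylindersC : setC_closed cylinders.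
Proof. by move=> A [r lA]; exists r; exact: locsetC. Qed.

Lemma cylindersU : setU_closed cylinders.
Proof.
move=> A B [r lA] [r' lB]; exists (r + r')%N => x y xy [Ax|Bx]; [left|right].
  by apply: lA Ax; apply: agree_le xy; exact: leq_addr.
by apply: lB Bx; apply: agree_le xy; exact: leq_addl.
Qed.

HB.instance Definition _ := @isAlgebraOfSets.Build default_measure_display cylinder_space
  cylinders cylinders0 cylindersU cylindersC.

Lemma sigma_cylinders : <<s @open X >> = <<s cylinders >>.
Proof.
apply/seteqP; split; apply: smallest_sub; try exact: smallest_sigma_algebra.
  move=> U oU; have [F lF ->] := open_bigcup_locset oU.
  case: (smallest_sigma_algebra setT cylinders) => _ _; apply=> r.
  by apply: sub_sigma_algebra; exists r.
by move=> A [r lA]; apply: sub_sigma_algebra; exact: locset_open lA.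
Qed.

(** * Frequencies of cylinders along averaging sets *)

Variable E : nat -> seq V.
Definition freq_avg k (A : set X) (x : X) : R :=
  (\sum_(g <- E k) (`[< A (act g x) >])%:R) / (size (E k))%:R.
Definition has_freq (A : set X) (t : R) :=
  forall e : R, 0 < e -> exists k0, forall k, (k0 <= k)%N ->
  (0 < size (E k))%N /\ forall x, `|freq_avg k A x - t| <= e.
Hypothesis Efreq : forall r A, locset r A -> exists t, has_freq A t.

Lemma has_freq_unique A t t' : has_freq A t -> has_freq A t' -> t = t'.
Proof.
move=> H H'; apply/eqP; rewrite -subr_eq0 -normr_le0; apply/ler_addgt0Pl => e e0.
rewrite addr0; have e2 : 0 < e / 2 by rewrite divr_gt0.
have [k Hk] := H _ e2; have [k' Hk'] := H' _ e2.
have [_ /(_ point) h] := Hk _ (leq_addr k' k); have [_ /(_ point) h'] := Hk' _ (leq_addl k k').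
apply: le_trans (ler_distD (freq_avg (k + k') A point) _ _) _.
by rewrite (distrC t); move: h h'; lra.
Qed.

Lemma freq_avg01 k A x : 0 <= freq_avg k A x <= 1.
Proof.
rewrite /freq_avg; have [s0|s0] := posnP (size (E k)).
  by rewrite s0 invr0 mulr0 lexx ler01.
rewrite divr_ge0 ?sumr_ge0 //= ler_pdivrMr ?ltr0n // mul1r -sum1_size natr_sum.
by apply: ler_sum => g _; rewrite ler_nat leq_b1.
Qed.

Lemma has_freq_ge0 A t : has_freq A t -> 0 <= t.
Proof.
move=> H; rewrite leNgt; apply/negP => t0; have e0 : 0 < - t / 2 by lra.
have [k /(_ _ (leqnn k))[_ /(_ point)]] := H _ e0.
by have /andP[] := freq_avg01 k A point; rewrite ler_norml; lra.
Qed.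

(** The default 0, for sets without frequency, keeps [freq] nonnegative everywhere. *)
Definition freq (A : set cylinder_space) : R := xget 0 [set t | has_freq A t].

Lemma freqP r A : locset r A -> has_freq A (freq A).
Proof. by move=> /Efreq[t tP]; rewrite /freq; case: xgetP => [? _ //|/(_ t)]. Qed.

Lemma freqE A t : has_freq A t -> freq A = t.
Proof.
move=> tP; rewrite /freq; case: xgetP => [t' _ t'P|/(_ t)//].
exact: has_freq_unique t'P tP.
Qed.

Lemma freq_ge0 A : 0 <= freq A.
Proof. by rewrite /freq; case: xgetP => [t _ /has_freq_ge0|_]. Qed.

Lemma freqT : freq [set: X] = 1.
Proof.
apply: freqE => e e0; have [t /(_ _ e0)[k0 H]] := Efreq (r := 0) (A := setT) (fun _ _ _ _ => I).
exists k0 => k /H[s0 _]; split=> // x; rewrite /freq_avg.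
have -> : \sum_(g <- E k) (`[< [set: X] (act g x) >])%:R = (size (E k))%:R :> R.
  by rewrite -sum1_size natr_sum; apply: eq_bigr => g _; rewrite asboolT.
by rewrite divff ?pnatr_eq0 -?lt0n // subrr normr0 ltW.
Qed.

Lemma freqU A B : cylinders A -> cylinders B -> A `&` B = set0 -> freq (A `|` B) = freq A + freq B.
Proof.
move=> [r lA] [r' lB] AB; apply: freqE => e e0; have e2 : 0 < e / 2 by rewrite divr_gt0.
have [k H] := freqP lA e2; have [k' H'] := freqP lB e2.
exists (k + k')%N => j kj; have [|s0 h] := H j; first by lia.
have [|_ h'] := H' j; first by lia.
split=> // x; have := h x; have := h' x.
suff -> : freq_avg j (A `|` B) x = freq_avg j A x + freq_avg j B x.
  by rewrite !ler_norml => /andP[? ?] /andP[? ?]; apply/andP; split; lra.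
rewrite /freq_avg -mulrDl -big_split /=; congr (_ / _); apply: eq_bigr => g _.
rewrite asbool_or.
case: asboolP => a; case: asboolP => b; rewrite ?addr0 ?add0r //.
by have : (A `&` B) (act g x) by []; rewrite AB.
Qed.

Lemma freq0 : freq set0 = 0.
Proof.
have := freqU cylinders0 cylinders0 (set0I _); rewrite setU0 => /eqP.
by rewrite -subr_eq0 opprD addNKr oppr_eq0 => /eqP.
Qed.

Definition cylinder_freq (A : set cylinder_space) : \bar R := (freq A)%:E.

Lemma cylinder_freq0 : cylinder_freq set0 = 0%E.
Proof. by rewrite /cylinder_freq freq0. Qed.

Lemma cylinder_freq_ge0 A : (0 <= cylinder_freq A)%E.
Proof. by rewrite lee_fin freq_ge0. Qed.

(* By compactness a cylinder is never an infinite disjoint union of nonempty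
   cylinders. *)
Lemma cylinder_freq_semi_sigma_additive : semi_sigma_additive cylinder_freq.
Proof.
move=> F mF tF [r lU]; set U := \bigcup_n F n in lU *.
have lF i : exists r, locset r (F i : set X) by exact: mF.
have Fo (i : nat) : setT i -> open (F i : set X).
  by move=> _; have [? lFi] := lF i; exact: locset_open lFi.
have Uc : compact (U : set X).
  have cU : closed (U : set X) := locset_closed lU.
  exact: (subclosed_compact cU (@subshift_compact d C R S z Sz Scl)) (fun _ _ => I).
have : U `<=` cover setT F by [].
move: Uc; rewrite compact_cover => /(_ nat setT F Fo)/[apply] -[D' _ UD].
pose n := (\max_(i <- D') i).+1.
have Fn i : (n <= i)%N -> F i = set0.
  move=> ni; rewrite -subset0 => x Fx; have [j /= jD Fj] := UD x (ex_intro2 _ _ i I Fx).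
  have ij : i = j by apply: tF => //; exists x.
  by move: ni; rewrite ij /n ltnNge leq_bigmax_seq.
have sumF m : (\sum_(0 <= i < m) cylinder_freq (F i) = cylinder_freq (\bigcup_(i < m) F i))%E.
  elim: m => [|m IH]; first by rewrite big_geq // bigcup_mkord big_ord0 cylinder_freq0.
  rewrite big_nat_recr //= IH !bigcup_mkord big_ord_recr /= -EFinD; congr (_%:E).
  rewrite -freqU //; last 1 first.
  - rewrite -subset0 => x [/=]; rewrite -bigcup_mkord => -[i /= im Fi] Fm.
    have := tF i m I I; move=> /(_ (ex_intro _ x (conj Fi Fm))) E'.
    by move: im; rewrite E' ltnn.
  - by apply: (@bigsetU_measurable _ cylinder_space) => i _; exact: mF.
apply: cvg_near_cst; exists n => // m /= nm; rewrite sumF; congr cylinder_freq.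
apply/seteqP; split=> x; first by move=> [i _ Fi]; exists i.
move=> [i _ Fi]; exists i => //=; rewrite ltnNge; apply/negP => mi.
by move: Fi; rewrite Fn // (leq_trans nm).
Qed.

HB.instance Definition _ := isMeasure.Build default_measure_display cylinder_space R cylinder_freq
  cylinder_freq0 cylinder_freq_ge0 cylinder_freq_semi_sigma_additive.

(** * Extension to Borel sets, invariance and uniqueness *)

Definition freq_measure (A : set (borelType X)) : \bar R := measure_extension cylinder_freq A.

Lemma freq_measureE r (A : set X) : locset r A -> freq_measure A = (freq A)%:E.
Proof.
move=> lA; rewrite /freq_measure /measure_extension measurable_mu_extE //.
by exists r.
Qed.

Lemma borel_cylinder (A : set (borelType X)) : measurable A ->
  (@measurable _ cylinder_space).-sigma.-measurable A.
Proof. by rewrite /measurable /= sigma_cylinders. Qed.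

Lemma freq_measure0 : freq_measure set0 = 0%E.
Proof. by rewrite (@freq_measureE 0) ?freq0. Qed.

Lemma freq_measure_ge0 A : (0 <= freq_measure A)%E.
Proof. exact: measure_ge0. Qed.

Lemma freq_measure_semi_sigma_additive : semi_sigma_additive freq_measure.
Proof.
move=> F mF tF mU.
apply: (@measure_semi_sigma_additive _ _ _ (measure_extension cylinder_freq)) => //.
- by move=> i; exact: borel_cylinder.
- exact: borel_cylinder.
Qed.

HB.instance Definition _ := isMeasure.Build _ (borelType X) R freq_measure
  freq_measure0 freq_measure_ge0 freq_measure_semi_sigma_additive.

Lemma freq_measureT : freq_measure setT = 1%E.
Proof. by rewrite (@freq_measureE 0) ?freqT. Qed.

HB.instance Definition _ :=
  Measure_isProbability.Build _ (borelType X) R freq_measure freq_measureT.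

Lemma locset_measurable r (A : set X) : locset r A -> measurable (A : set (borelType X)).
Proof. by move=> lA; apply: sub_sigma_algebra; exact: locset_open lA. Qed.

Lemma act_measurable g : measurable_fun setT (act g : borelType X -> borelType X).
Proof.
apply: (@measurability _ _ (borelType X) (borelType X) setT (act g) (@open X)) => // _ [U oU <-].
apply: sub_sigma_algebra; rewrite setTI; apply: open_comp => // x _.
exact: act_continuous.
Qed.

Lemma measure_eq_cylinders (m1 m2 : {measure set (borelType X) -> \bar R}) :
  (m1 setT < +oo)%E -> (forall r A, locset r A -> m1 A = m2 A) ->
  forall A, measurable A -> m1 A = m2 A.
Proof.
move=> m1oo m12 A mA.
apply: (@g_sigma_algebra_measure_unique _ R (borelType X) cylinders _ (fun=> setT)).
- by move=> B [r lB]; exact: locset_measurable lB.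
- by move=> _; exists 0%N.
- by rewrite bigcup_const.
- move=> B B' [r lB] [r' lB']; exists (r + r')%N => x y xy [Bx B'x]; split.
    by apply: lB Bx; apply: agree_le xy; exact: leq_addr.
  by apply: lB' B'x; apply: agree_le xy; exact: leq_addl.
- by move=> B [r lB]; exact: m12 lB.
- by [].
- by have := borel_cylinder mA.
Qed.

(** Convergence is uniform in the point, so [x] may be replaced by [act g x]. *)
Lemma freq_act g r A : locset r A -> freq (act g @^-1` A) = freq A.
Proof.
move=> lA; apply: freqE => e e0; have [k H] := freqP lA e0.
exists k => j /H[s0 h]; split=> // x.
suff -> : freq_avg j (act g @^-1` A) x = freq_avg j A (act g x) by [].
rewrite /freq_avg; congr (_ / _); apply: eq_bigr => h' _.
by rewrite /preimage /= -!actD addrC.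
Qed.

Lemma freq_measure_invariant (F : set V) :
  invariant_under act F (freq_measure : probability (borelType X) R).
Proof.
move=> g _ A mA; have mg := act_measurable g.
pose f : borelType X -> borelType X := act g.
suff : pushforward freq_measure f A = freq_measure A by [].
apply: (measure_eq_cylinders (m1 := pushforward freq_measure f) (m2 := freq_measure)) mA => [|r B lB].
  by rewrite /= /pushforward preimage_setT freq_measureT ltry.
rewrite /= /pushforward; have [r' l'] := locset_act g lB.
by rewrite (freq_measureE lB) (freq_measureE l') (freq_act g lB).
Qed.

(** Integrate the averages over [E k]: each term has integral [nu A] by invariance, since [E k] lies
    in [F], while pointwise the average is at most [freq A + e]. *)
Lemma freq_measure_ub (F : set V) (nu : probability (borelType X) R) k1 :
  invariant_under act F nu -> (forall k, (k1 <= k)%N -> forall g, g \in E k -> F g) ->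
  forall r A, locset r A -> (nu A <= (freq A)%:E)%E.
Proof.
move=> nuF EF r A lA; have mA := locset_measurable lA.
apply/lee_addgt0Pr => e e0; have [k H] := freqP lA e0.
have [s0 {}H] := H _ (leq_addr k1 k); set j := (k + k1)%N in s0 H.
have mgA g : measurable (act g @^-1` A : set (borelType X)).
  by have [r' l'] := locset_act g lA; exact: locset_measurable l'.
have s0R : 0 < (size (E j))%:R :> R by rewrite ltr0n.
pose ind g : borelType X -> \bar R := fun x => (\1_(act g @^-1` A : set (borelType X)) x)%:E.
have mI g : measurable_fun [set: borelType X] (ind g).
  by apply/measurable_EFinP; exact: measurable_indic.
have intE : (\int[nu]_x (\sum_(g <- E j) ind g x)
    = \sum_(g <- E j) nu A)%E.
  rewrite ge0_integral_sum // => [|g x _]; last by rewrite lee_fin.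
  apply: eq_big_seq => g gE; rewrite integral_indic // setIT; apply: nuF => //.
  by apply: EF gE; rewrite leq_addl.
have ub : (\int[nu]_x (\sum_(g <- E j) ind g x)
    <= (((freq A + e) * (size (E j))%:R)%:E))%E.
  have -> : ((freq A + e) * (size (E j))%:R)%:E =
      (\int[nu]_(x in [set: borelType X]) cst ((freq A + e) * (size (E j))%:R)%:E x)%E.
    by rewrite integral_cst // [X in (_ * X)%E](probability_setT nu) mule1.
  apply: ge0_le_integral => //.
  - by move=> x _; apply: sume_ge0 => g _; rewrite lee_fin.
  - exact: emeasurable_sum.
  - move=> x _; rewrite /= sumEFin lee_fin.
    have -> : \sum_(g <- E j) \1_(act g @^-1` A : set (borelType X)) x =
        \sum_(g <- E j) (`[< A (act g x) >])%:R :> R.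
      apply: eq_bigr => g _; rewrite indicE; congr (nat_of_bool _)%:R. 
    rewrite -ler_pdivrMr //; have := H (x : X); rewrite ler_norml /freq_avg => /andP[_].
    by rewrite lerBlDl addrC.
rewrite intE in ub; have nufin : nu A \is a fin_num by exact: fin_num_measure.
move: ub; rewrite -(fineK nufin) sumEFin lee_fin.
have -> : \sum_(g <- E j) fine (nu A) = fine (nu A) * (size (E j))%:R.
  by rewrite big_const_seq count_predT iter_addr_0 mulr_natr.
by rewrite ler_pM2r // -EFinD lee_fin.
Qed.

(** The upper bound for the complement of a cylinder is a lower bound for the cylinder. *)
Lemma freq_measure_unique (F : set V) (nu : probability (borelType X) R) k1 :
  invariant_under act F nu -> (forall k, (k1 <= k)%N -> forall g, g \in E k -> F g) ->
  forall A, measurable A -> nu A = freq_measure A.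
Proof.
move=> nuF EF; apply: (measure_eq_cylinders (m1 := nu)) => [|r A lA].
  by suff : (nu setT < +oo)%E by []; rewrite probability_setT ltry.
have mA := locset_measurable lA; have lC := locsetC lA.
transitivity (freq A)%:E; last exact: (esym (freq_measureE lA)).
apply/eqP; rewrite eq_le (freq_measure_ub nuF EF lA) /=.
have := freq_measure_ub nuF EF lC; rewrite probability_setC //.
have -> : freq (~` A) = 1 - freq A.
  have := freqU (ex_intro _ r lA : cylinders A) (ex_intro _ r lC : cylinders (~` A)) (setICr A).
  by rewrite setUv freqT => ->; rewrite addrC addKr.
have nufin : nu A \is a fin_num by exact: fin_num_measure.
by rewrite -(fineK nufin) -EFinB !lee_fin; lra.
Qed.

End action.

(** * The dynamical system *)

Section conclusion.
Variables (R : realType) (d : nat) (C : finType) (c0 : C).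
Local Notation V := 'rV[int]_d.
Local Notation cfg := (V -> C).
Variables (P : set V) (M : R) (Lv : nat -> level d C) (l e z : nat -> nat).
Local Notation N k := (side (Lv k)).
Hypothesis TW : tower c0 P Lv (fun k => k.+1`!) factorial l e z.
Hypothesis inv : forall k, level_inv M k (Lv k).
Hypothesis good : forall k, good_step R c0 P k (Lv k) (Lv k.+1) (l k) (e k) (z k).
Variables (x0 : cfg) (Sx0 : tower_shift Lv x0).
Local Notation S := (tower_shift Lv).
Local Notation X := (subshift R Sx0).
Local Notation Sinv := (fun g x => @tower_shift_invariant d C Lv g x).
Local Notation act := (act Sinv : V -> X -> X).
Local Notation E := (avg_set Lv factorial).
Local Notation Scl := (@tower_shift_closed d C Lv).

(** * Total strict ergodicity *)

Lemma tower_freq r (A : set X) : locset r A -> exists t, has_freq Sinv E A t.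
Proof.
(* Frequencies are computed in blocks, so the event must be defined on all configurations, not only
   on points of the subshift. *)
move=> lA; pose w (y : cfg) := `[< exists2 x : X, agree r (config x) y & A x >].
have lw : local r w.
  move=> y y' yy'; apply/idP/idP => /asboolP[x xy Ax]; apply/asboolP; exists x => //.
    exact: agree_trans yy'.
  exact: agree_trans (agree_sym yy').
have wA (x : X) : w (config x) = `[< A x >].
  apply/idP/idP => /asboolP; last by move=> Ax; apply/asboolP; exists x.
  by move=> [y yx Ay]; apply/asboolP; exact: lA yx Ay.
have [t tP] := unif_freq (R := R) TW (fun k => step_shape (good k))
  (fun k => step_err (good k)) (fun k => leq_trans (leq_addr _ _) (inv_large (inv k)))
  (fun k => leq_fact (leqnSn k)) lw.
exists t => e' /tP[k0 H]; exists k0 => k /H[s0 h]; split=> // x.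
have := h _ (proj2_sig x).
suff -> : avg R Lv factorial k w (config x) = freq_avg Sinv E k A x by [].
by rewrite /avg /freq_avg; congr (_ / _); apply: eq_bigr => g _; rewrite -wA.
Qed.

(** The pattern of [y] lies in a block of some level K with [n] dividing K!. That block occurs in
    every block of level K+1 in all classes modulo K!; one occurrence puts the pattern at a multiple
    of [n]. *)
Lemma tower_dense_orbits n (x y : X) r : (0 < n)%N ->
  exists g : V, (forall i, (n %| `|g ord0 i|)%N) /\ agree r (config y) (config (act g x)).
Proof.
(* Radius [r.+1] puts 0 in the window, so that [v] itself is a cell of the block. *)
move=> n0; have [k] := proj2_sig y r.+1.
move=> /(appears_ge TW n); rewrite addnC; set K := (n + k)%N => -[w wb [v vw]].
have nK : (n %| K`!)%N by rewrite dvdn_fact // n0 leq_addr.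
have [f [_ _ fL]] := tower_tiling TW K.+1 1 (proj2_sig x).
pose j0 : cube d 1 := [ffun=> ord0].
pose al i := f i (j0 i).
have v0 : exists i : cube d (N K), v = cell i.
  have [|/box0P[i vi] _] := vw 0; last by exists i; rewrite -vi addr0.
  by move=> i; rewrite mxE; lia.
have [iv ivE] := v0.
have [h [_ hm hw]] := blkS_occurs TW (fun i => al i + iv i)%N (fL j0) wb.
exists (vec al + vec h + v); split=> [i|g rg].
  apply: dvdn_trans nK _; have := hm i; rewrite ivE /cell !mxE.
  by rewrite -!PoszD absz_nat addnAC.
have [|/box0P[i vi] yE] := vw g.
  by move=> i; have := rg i; move: (g _ _) => u /andP[? ?]; apply/andP; split; lia.
by transitivity (w (v + g)); [exact: yE|rewrite vi -hw config_act /shift -!addrA vi].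
Qed.


(** By pigeonhole on cosets some positive multiple of each basis vector is in [F]; the product of
    the multipliers works. *)
Lemma finite_index_dvd (F : set V) : is_subgroup F -> finite_index F ->
  exists n, (0 < n)%N /\ forall g : V, (forall i, (n %| `|g ord0 i|)%N) -> F g.
Proof.
move=> [F0 FB] fi.
have FN g : F g -> F (- g) by move=> Fg; rewrite -sub0r; exact: FB.
have FD g h : F g -> F h -> F (g + h) by move=> Fg /FN Fh; rewrite -[h]opprK; exact: FB.
have Fn g n : F g -> F (g *+ n).
  by move=> Fg; elim: n => [|n IH]; rewrite ?mulr0n // mulrS; exact: FD.
pose b (i : 'I_d) : V := delta_mx ord0 i.
have pos i : exists n, (0 < n)%N /\ F (b i *+ n).
  pose c (j : nat) := [set b i *+ j + h | h in F].
  have [j [j' [jj' cE]]] : exists j j', (j < j')%N /\ c j = c j'.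
    apply: contrapT => nE; have cinj : injective c.
      by move=> j j' cE; case: (ltngtP j j') => // jj'; case: nE;
        [exists j, j'|exists j', j].
    apply: infinite_nat; have := finite_preimage (f := c) (in2W cinj) fi.
    by congr finite_set; apply/seteqP; split=> // j _; exists (b i *+ j).
  exists (j' - j)%N; split; first by rewrite subn_gt0.
  have : c j' (b i *+ j') by exists 0; rewrite ?addr0.
  rewrite -cE => -[h Fh hE]; rewrite mulrnBr ?(ltnW jj') // -hE addrC addKr //.
have [n nP] := choice pos.
exists (\prod_i n i)%N; split; first by apply: prodn_gt0 => i; have [] := nP i.
move=> g gn; rewrite [g]row_sum_delta; apply: (big_ind F) => // i _.
have ni : (n i %| `|g ord0 i|)%N.
  by apply: dvdn_trans (gn i); rewrite (bigD1 i) //= dvdn_mulr.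
have Fk k : (n i %| k)%N -> F (b i *+ k).
  by move=> /dvdnP[q ->]; rewrite mulnC mulrnA; apply: Fn; have [] := nP i.
move: ni; case: (g _ i) => u nu.
  by rewrite -[Posz u]natz scaler_nat; exact: Fk.
by rewrite NegzE scaleNr -[Posz _]natz scaler_nat; apply: FN; exact: Fk.
Qed.

Lemma tower_strictly_ergodic : totally_strictly_ergodic act.
Proof.
move=> F sF fF; have [n [n0 nF]] := finite_index_dvd sF fF; split.
  move=> x O [y Oy] oO; have : nbhs y O by move: oO; rewrite openE; apply.
  move=> /nbhs_agree[r rO]; have [g [gn yx]] := tower_dense_orbits x y r n0.
  by exists (act g x); split; [exact: rO|exists g => //; exact: nF].
exists (freq_measure Scl tower_freq : probability (borelType X) R); split.
  exact: freq_measure_invariant.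
move=> nu nuF; apply: (freq_measure_unique Scl tower_freq (k1 := n) nuF) => k nk g.
rewrite /avg_set => /mapP[i]; rewrite mem_filter => /andP[/forallP iP _] ->.
apply: nF => j; rewrite mxE absz_nat; apply: dvdn_trans (iP j).
by rewrite dvdn_fact // n0.
Qed.


(** * Divergence on a residual set *)

Definition letter_test (c : C) (x : X) : R := (config x 0 == c)%:R.

Lemma letter_test_continuous c : continuous (letter_test c).
Proof.
move=> x A Ax; apply/nbhs_agree; exists 1%N => y xy.
have z0 : sym_cube 1 (0 : V) by move=> i; rewrite mxE.
by rewrite /= /letter_test -(xy _ z0); exact: nbhs_singleton Ax.
Qed.

Lemma finite_sym_cube n : finite_set (@sym_cube d n).
Proof.
apply: (sub_finite_set (B := [set cell i - vec (fun=> n) | i in [set: cube d n.*2]])).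
  move=> g gn; have /box0P[i iE] : box 0 (const_mx n.*2) (g + vec (fun=> n)).
    by move=> i; have := gn i; rewrite !mxE; move: (g _ _) => u /andP[? ?]; apply/andP; split; lia.
  by exists i => //; rewrite -iE addrK.
by apply: finite_image; exact: finite_finset.
Qed.

Local Notation Q n := (fset_set (P `&` sym_cube n)).

Lemma finite_P_cube n : finite_set (P `&` sym_cube n).
Proof. by apply: sub_finite_set (finite_sym_cube n) => g []. Qed.

Lemma in_P_cube n g : (g \in Q n) = `[< P g /\ sym_cube n g >].
Proof.
rewrite (in_fset_set (finite_P_cube n)); apply/idP/idP => [/set_mem h|/asboolP h].
  exact/asboolP.
exact: mem_set.
Qed.

Lemma ergodic_average_count c x n : ergodic_average act P (letter_test c) x n =
  (count (fun g => config x g == c) (Q n))%:R / (#|` Q n|)%:R.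
Proof.
rewrite /ergodic_average mulrC (fsbig_finite _ _ (finite_P_cube n)) /=; congr (_ / _).
rewrite -sum1_count natr_sum [RHS]big_mkcond /=; apply: eq_bigr => g _.
by rewrite /letter_test config_act /shift addr0; case: ifP.
Qed.

Hypothesis P_infinite : infinite_set P.

Lemma card_P_cube_large K : exists n0, forall n, (n0 <= n)%N -> (K <= #|` Q n|)%N.
Proof.
have [B BP KB] := infinite_set_fset K P_infinite.
exists (\sum_(g <- B) (\sum_i `|g ord0 i|).+1)%N => n nB.
apply: leq_trans KB _; apply: fsubset_leq_card; apply/fsubsetP => g gB.
rewrite in_P_cube; apply/asboolP; split; first exact: BP.
move=> i; have := sym_cube_norm g i.
have : ((\sum_i `|g ord0 i|).+1 <= n)%N.
  by apply: leq_trans nB; rewrite (big_fsetD1 g) //= leq_addr.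
by move: (\sum_i _).+1 (g _ _) => k u kn /andP[? ?]; apply/andP; split; lia.
Qed.

(** All exceptions lie in the one block that contains the window of [y], so their number is bounded
    independently of [n]. *)
Lemma letter_along_P (c : C) (y : X) r : exists x : X, agree r (config y) (config x) /\
  exists K, forall n, (count (fun g => config x g != c) (Q n) <= K)%N.
Proof.
have [k [w wb [v vw]]] := proj2_sig y r.
have [|x [xS xY xu]] := ex_point TW (k := k) (v := - v) (Y := shift v w) (fun=> c).
  by rewrite -shiftD addrN shift0.
exists (exist _ x xS); split=> [g rg /=|].
  have [/box0P[i vE] yE] := vw g rg.
  transitivity (w (v + g)); first exact: yE.
  by rewrite xY //; apply/boxP; exists i; rewrite -vE addKr.
exists #|{: cube d (N k)}| => n; rewrite -size_filter cardE -(size_map (fun i => - v + cell i)).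
apply: uniq_leq_size; first by rewrite filter_uniq // fset_uniq.
move=> g; rewrite mem_filter in_P_cube => /andP[xg /asboolP[Pg _]].
have [/boxP[i gE]|nb] := pselect (box (- v) (const_mx (N k)) g).
  by apply/mapP; exists i; rewrite ?mem_enum.
by move: xg; rewrite /= (xu g Pg nb) eqxx.
Qed.

Variables (c1 : C) (c10 : c1 != c0).
Local Notation A := (ergodic_average act P (letter_test c1)).

Lemma avg_agree n (x y : X) : agree n (config x) (config y) -> A x n = A y n.
Proof.
move=> xy; rewrite !ergodic_average_count; congr (_%:R / _); apply: eq_in_count => g.
by rewrite in_P_cube => /asboolP[_ /xy ->].
Qed.

Lemma open_avg (B : set R) j : open [set x : X | exists2 n, (j <= n)%N & B (A x n)].
Proof.
rewrite openE => x [n jn Bx]; apply/nbhs_agree; exists n => y xy.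
by exists n => //; rewrite -(avg_agree xy).
Qed.

Lemma dense_avg_gt j : dense [set x : X | exists2 n, (j <= n)%N & 2 / 3 < A x n].
Proof.
move=> O [y Oy] oO; have : nbhs y O by move: oO; rewrite openE; apply.
move=> /nbhs_agree[r rO]; have [x [yx [K xK]]] := letter_along_P c1 y r.
(* Among more than 3 K points of [P], at most K exceptions are less than a third. *)
have [n0 n0P] := card_P_cube_large (3 * K).+1; have Qn := n0P _ (leq_addl j n0).
exists x; split; first exact: rO.
exists (j + n0)%N; first exact: leq_addr.
rewrite ergodic_average_count ltr_pdivlMr ?ltr0n; last by apply: leq_trans Qn.
have vK := xK (j + n0)%N.
have : (count (fun g => config x g == c1) (Q (j + n0)%N) +
  count (fun g => config x g != c1) (Q (j + n0)%N) = #|` Q (j + n0)%N|)%N := count_predC _ _.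
move: (count _ _) (count _ _) (#|` _|) vK Qn => u v q vK Qn uv.
rewrite mulrAC ltr_pdivrMr // -!natrM ltr_nat; lia.
Qed.

Lemma dense_avg_lt j : dense [set x : X | exists2 n, (j <= n)%N & A x n < 1 / 3].
Proof.
move=> O [y Oy] oO; have : nbhs y O by move: oO; rewrite openE; apply.
move=> /nbhs_agree[r rO]; have [x [yx [K xK]]] := letter_along_P c0 y r.
have [n0 n0P] := card_P_cube_large (3 * K).+1; have Qn := n0P _ (leq_addl j n0).
exists x; split; first exact: rO.
exists (j + n0)%N; first exact: leq_addr.
rewrite ergodic_average_count ltr_pdivrMr ?ltr0n; last by apply: leq_trans Qn.
have h : (count (fun g => config x g == c1) (Q (j + n0)%N) <= K)%N.
  apply: leq_trans (xK (j + n0)%N); apply: sub_count => g /eqP ->; exact: c10.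
move: (count _ _) h Qn => u uK Qn.
rewrite mulrAC ltr_pdivlMr // mul1r -natrM ltr_nat; lia.
Qed.

Lemma residual_divergence : residual [set x : X | ~ cvgn (A x)].
Proof.
exists (fun k => if odd k then [set x : X | exists2 n, (k <= n)%N & 2 / 3 < A x n]
  else [set x : X | exists2 n, (k <= n)%N & A x n < 1 / 3]); split.
  move=> k; case: ifP => _; split.
  - exact: (open_avg (B := [set t : R | 2 / 3 < t]) (j := k)).
  - exact: dense_avg_gt.
  - exact: (open_avg (B := [set t : R | t < 1 / 3]) (j := k)).
  - exact: dense_avg_lt.
(* Averages within 1 / 7 of a limit differ by less than 2 / 7, but some are more than 1 / 3
   apart. *)
move=> x H /cvg_ex[/= t /cvgrPdist_lt/(_ (1 / 7))].
have e7 : 0 < 1 / 7 :> R by lra.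
move=> /(_ e7)[n0 _ tn]; have := H (n0.*2.+1) I; have := H n0.*2 I.
rewrite /= odd_double /= => -[n n0n lo] [n' n0n' hi].
have h1 : (n0 <= n)%N by move: n0n; rewrite -addnn; lia.
have h2 : (n0 <= n')%N by move: n0n'; rewrite -addnn; lia.
have := tn n h1; have := tn n' h2; rewrite /= !ltr_norml.
by move: (A x n) (A x n') lo hi => u v ? ? /andP[? ?] /andP[? ?]; lra.
Qed.

(** * Entropy *)

Definition letter_cover : set (set X) := [set [set x : X | config x 0 = c] | c in [set: C]].

Lemma letter_cover_open : open_cover letter_cover.
Proof.
split; last first.
  apply/seteqP; split=> // x _; exists [set y : X | config y 0 = config x 0] => //.
  by exists (config x 0).
move=> _ [c _ <-]; apply: (locset_open (r := 1)) => x y xy <-.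
by apply/esym/xy => i; rewrite mxE.
Qed.

Lemma join_restr n (B : set X) (x y : X) : cover_join act letter_cover n B ->
  B x -> B y -> restr n (config x) = restr n (config y).
Proof.
move=> [D DC <-] Bx By; apply/ffunP => i; rewrite !ffunE.
have bi : box 0 (const_mx n) (cell i) by apply/box0P; exists i.
have [c _ cE] := DC _ bi; have := Bx _ bi; have := By _ bi.
by rewrite -cE /= /shift addr0 => -> ->.
Qed.

(** Every block is the pattern of some point on the cube, and each member of the join admits only
    one pattern there. *)
Lemma subcover_number_ge k :
  (#|blocks (Lv k)|)%:R <= subcover_number R (cover_join act letter_cover (N k)).
Proof.
apply: lb_le_inf.
  (* The infimum is over a nonempty set: the patterns give a finite subcover. *)
  exists (#|{: pat d C (N k)}|)%:R; exists #|{: pat d C (N k)}| => //=.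
  exists (fun i => \bigcap_(g in box 0 (const_mx (N k)))
    act g @^-1` [set x : X | config x 0 = ext c0 (enum_val i) g]); split.
    by move=> i; exists (fun g => [set x : X | config x 0 = ext c0 (enum_val i) g]) => // g _;
      exists (ext c0 (enum_val i) g).
  apply/seteqP; split=> // x _; exists (enum_rank (restr (N k) (config x))) => // g /box0P[i ->].
  by rewrite /= enum_rankK ext_cell ffunE /shift addr0.
move=> _ [n [B [BC cov]] <-]; rewrite ler_nat.
have pt b : exists ix : 'I_n * X, b \in blocks (Lv k) -> B ix.1 ix.2 /\ restr (N k) (config ix.2) = b.
  have [bL|nb] := boolP (b \in blocks (Lv k)); last first.
    have : (\bigcup_i B i) (exist _ x0 Sx0 : X) by rewrite cov.
    by move=> [i _ _]; exists (i, exist _ x0 Sx0).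
  have [|x [xS xb _]] := ex_point TW (k := k) (v := 0) (Y := ext c0 b) (fun=> c0).
    by rewrite shift0; exact: blk_ext.
  have : (\bigcup_i B i) (exist _ x xS : X) by rewrite cov.
  move=> [i _ Bi]; exists (i, exist _ x xS) => _; split=> //=.
  apply/ffunP => j; rewrite ffunE xb ?ext_cell //.
  by apply/box0P; exists j.
have [F FP] := choice pt.
have F_inj : {in blocks (Lv k) &, injective (fun b => (F b).1)}.
  move=> b b' bL b'L /= E'; have [Bb <-] := FP b bL; have [Bb' <-] := FP b' b'L.
  by rewrite E' in Bb; exact: join_restr (BC _) Bb Bb'.
by have := leq_card_in _ _ F_inj; rewrite card_ord.
Qed.

(** A limsup is bounded below along the sides [N k], which are unbounded since [k <= N k]. *)
Lemma topological_entropy_ge : (M%:E <= topological_entropy act)%E.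
Proof.
apply: (@le_trans _ _ (cover_entropy act letter_cover)); last first.
  by apply: ereal_sup_ubound; exists letter_cover => //; exact: letter_cover_open.
rewrite /cover_entropy /limn_esup /limf_esup; apply: le_ereal_inf_tmp => _ [W [n0 _ n0W] <-].
have Nn k : (k <= N k)%N.
  apply: leq_trans (inv_large (inv k)); apply: leq_trans (leq_addr _ _).
  by rewrite leq_pmulr // expn_gt0 fact_gt0.
set u := fun n : nat => _; apply: (@le_trans _ _ (u (N n0))); last first.
  by apply: ereal_sup_ubound; exists (N n0) => //; apply: n0W; exact: Nn.
rewrite /u lee_fin ler_pdivlMr ?ltr0n ?expn_gt0 ?(side_gt0 TW) //.
apply: (@le_trans _ _ (ln (#|blocks (Lv n0)|)%:R)).
  apply: le_trans (inv_entropy (inv n0)); rewrite ler_wpM2r ?ler0n //.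
  by rewrite /entropy_rate lerDl divr_ge0 // exprn_ge0.
have b0 : 0 < (#|blocks (Lv n0)|)%:R :> R by rewrite ltr0n; exact: inv_blocks (inv n0).
have := subcover_number_ge n0 => h; rewrite ler_ln ?posrE //.
exact: lt_le_trans h.
Qed.

End conclusion.

Theorem theorem1p2 (R : realType) (d : nat) (d_gt1 : (1 < d)%N)
    (P : set 'rV[int]_d) (P_infinite : infinite_set P)
    (P_density0 : upper_banach_density R P = 0%E) :
  forall M : R, 0 <= M ->
  exists (X : pmetricType R) (T : 'rV[int]_d -> X -> X)
         (mu : probability (borelType X) R) (f : X -> R),
    [/\ compact [set: X] /\ continuous_action T,
        totally_strictly_ergodic T /\ invariant_under T setT mu,
        continuous f,
        residual [set x | ~ cvgn (ergodic_average T P f x)] &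
        (M%:E <= topological_entropy T)%E].
Proof.
move=> M M0; have d0 : (0 < d)%N by exact: ltnW.
(* With n + 2 letters the logarithm is at least [M + 4], and there are two distinct letters to tell
   apart. *)
pose n := Num.truncn (expR (M + 4)).
pose C : finType := 'I_n.+2.
have MC : M + 4 <= ln #|C|%:R.
  rewrite card_ord -ler_expR lnK ?posrE ?ltr0n //.
  by apply: ltW; apply: lt_trans (truncnS_gt _) _; rewrite ltr_nat.
have [Lv [l [e [z [TW inv good]]]]] := ex_tower (ord0 : C) d0 P_density0 M0 MC.
have [x0 Sx0] := ex_tower_shift TW.
have c10 : (ord_max : C) != (ord0 : C) by [].
exists (subshift R Sx0), (act (fun g x => @tower_shift_invariant d C Lv g x)),
  (freq_measure (@tower_shift_closed d C Lv) (tower_freq TW inv good (Sx0 := Sx0))),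
  (letter_test (ord_max : C)); split.
- split; first exact: subshift_compact (@tower_shift_closed d C Lv).
  exact: act_continuous_action.
- split; first exact: (tower_strictly_ergodic TW inv good).
  exact: freq_measure_invariant.
- exact: letter_test_continuous.
- exact: (residual_divergence R TW Sx0 P_infinite c10).
- exact: (topological_entropy_ge TW inv).
Qed.
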